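(* Let $A\subseteq\omega$ be a set which is not computably enumerable. Then every compact Polish space $X$ has a Polish presentation $d$ such that $A$ is not computably enumerable relative to $d$.
   Context: A Polish presentation of a Polish space $X$ is a metric $d$ on $\omega$ whose Cauchy completion is homeomorphic to $X$. A set is c.e. relative to $d$ if it is c.e. relative to (an oracle coding) the set $\{(i,j,p,q)\in\omega^2\times\mathbb{Q}^2 : p<d(i,j)<q\}$.
   Formalization: A metric on ω has an infinite completion, so the claim fails literally for finite X; here X is assumed nonempty, and for finite X the presentation d may be a pseudometric (points repeated), while for infinite X it is a genuine metric as stated. *)

(* Defs.v *)
From HB Require Import structures.
From Stdlib Require Cantor.
From mathcomp Require Import all_boot all_order all_algebra.
From mathcomp Require Import all_classical all_reals all_analysis.

Set Implicit Arguments.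
Unset Strict Implicit.
Unset Printing Implicit Defensive.

Import Order.TTheory GRing.Theory Num.Theory.

Local Open Scope classical_set_scope.
Local Open Scope ring_scope.

(** * Relative computability *)

Definition npair (a b : nat) : nat := Stdlib.Arith.Cantor.to_nat (a, b).
Definition nunpair (n : nat) : nat * nat := Stdlib.Arith.Cantor.of_nat n.

Lemma npairK (a b : nat) : nunpair (npair a b) = (a, b).
Proof. exact: Stdlib.Arith.Cantor.cancel_of_to. Qed.

Lemma nunpairK (n : nat) : npair (nunpair n).1 (nunpair n).2 = n.
Proof.
by rewrite /npair -surjective_pairing; exact: Stdlib.Arith.Cantor.cancel_to_of.
Qed.

(** Kleene's partial recursive functions relative to an oracle. Programs are
    unary; several arguments are passed through the Cantor pairing. *)
Inductive prog : Type :=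
  | PZero
  | PSucc
  | PFst
  | PSnd
  | POracle
  | PPair of prog & prog
  | PComp of prog & prog
  | PPrec of prog & prog
  | PMu of prog.

(** [peval O c n r]: with oracle [O], program [c] halts on input [n] with
    output [r]. *)
Fixpoint peval (O : set nat) (c : prog) : nat -> nat -> Prop :=
  match c with
  | PZero => fun n r => r = 0%N
  | PSucc => fun n r => r = n.+1
  | PFst => fun n r => r = (nunpair n).1
  | PSnd => fun n r => r = (nunpair n).2
  | POracle => fun n r => (O n /\ r = 1%N) \/ (~ O n /\ r = 0%N)
  | PPair f g => fun n r =>
      exists a b, [/\ peval O f n a, peval O g n b & r = npair a b]
  | PComp f g => fun n r => exists2 m, peval O g n m & peval O f m r
  (* h(a, 0) = f(a) and h(a, k + 1) = g(a, (k, h(a, k))) *)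
  | PPrec f g => fun n =>
      let a := (nunpair n).1 in
      (fix h (k : nat) : nat -> Prop :=
         match k with
         | 0%N => peval O f a
         | k'.+1 => fun r =>
             exists2 y, h k' y & peval O g (npair a (npair k' y)) r
         end) (nunpair n).2
  (* the least m with f(n, m) = 0, all earlier values being defined *)
  | PMu f => fun n m =>
      peval O f (npair n m) 0%N /\
      forall k, (k < m)%N -> exists v, peval O f (npair n k) v.+1
  end.

(** c.e. relative to [O]: the domain of a partial [O]-recursive function. *)
Definition ce_in (O A : set nat) : Prop :=
  exists c : prog, forall n : nat, A n <-> exists r, peval O c n r.

Definition ce (A : set nat) : Prop := ce_in set0 A.

(** * Coding of [{(i, j, p, q) | p < d(i, j) < q}] *)

(** An effective numbering of the rationals (with repetitions). *)
Definition rat_of_code (n : nat) : rat :=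
  let: (a, m) := nunpair n in
  let: (b, c) := nunpair m in
  (a%:R - b%:R) / c.+1%:R.

Lemma rat_of_code_surj (q : rat) : exists n, rat_of_code n = q.
Proof.
have [c cE] : exists c : nat, denq q = c.+1%:Z.
  by case: (denq q) (denq_gt0 q) => [[|c]|c] // _; exists c.
have [a [b abE]] : exists a b : nat, numq q = a%:Z - b%:Z.
  case: (numq q) => k; first by exists k, 0%N; rewrite subr0.
  by exists 0%N, k.+1; rewrite sub0r NegzE.
exists (npair a (npair b c)); rewrite /rat_of_code !npairK.
by rewrite -[RHS]divq_num_den cE abE rmorphB.
Qed.

(** The quadruple [(i, j, p, q)] is coded by [npair (npair i j) (npair k l)] for
    any codes [k] of [p] and [l] of [q]. *)
Definition metric_oracle (R : realType) (d : nat -> nat -> R) : set nat :=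
  [set n | let: (ij, kl) := nunpair n in
           let: (i, j) := nunpair ij in
           let: (k, l) := nunpair kl in
           ratr (rat_of_code k) < d i j < ratr (rat_of_code l)].

Definition ce_rel_metric (R : realType) (d : nat -> nat -> R) (A : set nat) :
    Prop :=
  ce_in (metric_oracle d) A.

(** * Polish spaces and their presentations *)

Definition homeomorphic (X Y : topologicalType) : Prop :=
  exists (f : X -> Y) (g : Y -> X),
    [/\ cancel f g, cancel g f, continuous f & continuous g].

(** As in the library's [completeType], without requiring a base point. *)
Definition complete_metric_space (R : realType) (Y : metricType R) : Prop :=
  forall F : set_system Y, ProperFilter F -> cauchy F -> exists y : Y, F --> y.

Definition separable_space (X : topologicalType) : Prop :=
  exists2 S : set X, countable S & dense S.

Definition polish_space (R : realType) (X : topologicalType) : Prop :=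
  separable_space X /\
  exists2 Y : metricType R, complete_metric_space Y & homeomorphic Y X.

Definition pseudometric_on (T : Type) (R : realType) (d : T -> T -> R) : Prop :=
  [/\ forall i, d i i = 0,
      forall i j, d i j = d j i &
      forall i j k, d i k <= d i j + d j k].

Definition metric_on (T : Type) (R : realType) (d : T -> T -> R) : Prop :=
  pseudometric_on d /\ forall i j, d i j = 0 -> i = j.

(** [(Y, iota)] is a Cauchy completion of [(T, d)]; it is unique up to isometry.
    For a pseudometric [d] it identifies the points at distance 0. *)
Definition cauchy_completion (T : Type) (R : realType) (d : T -> T -> R)
    (Y : metricType R) (iota : T -> Y) : Prop :=
  [/\ complete_metric_space Y,
      forall i j, mdist (iota i) (iota j) = d i j &
      dense (range iota)].

(** For infinite [X] this is: a metric on the naturals whose Cauchy completion is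
    homeomorphic to [X]. The completion of a metric on the naturals is always
    infinite, so a finite [X] has no such presentation; for finite [X] the metric
    is therefore allowed to be degenerate (points may be repeated). *)
Definition polish_presentation (R : realType) (X : topologicalType)
    (d : nat -> nat -> R) : Prop :=
  [/\ pseudometric_on d,
      infinite_set [set: X] -> metric_on d &
      exists (Y : metricType R) (iota : nat -> Y),
        cauchy_completion d iota /\ homeomorphic Y X].

(* Main.v *)
(* Conditions are finite approximations: a metric [e] on [X], finitely many
   distinct points with rational distances, and a tolerance. Extending a
   condition adds points, keeps the distances of the old ones and changes [e] by
   at most half of the tolerance, so that a sequence of conditions converges to a
   presentation with rational distances. Compactness provides a finite set of
   points such that every other point is near an accumulation point of the set;
   once it is part of the condition, the finite rational metrics that occur in
   its extensions are exactly those in which each new point is close to one of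
   these accumulation points: any such metric is realized by choosing points near
   the accumulation points and perturbing [e]. This is decidable, hence the
   numbers on which a given program can be made to halt by some extension form a
   c.e. set. It differs from [A], and at a number where it does the program is
   prevented from enumerating [A]: either an extension makes it halt outside [A],
   or no extension makes it halt on some element of [A]. *)
From HB Require Import structures.
Require Import Defs.
From mathcomp Require Import all_boot all_order all_algebra.
From mathcomp Require Import all_classical all_reals all_analysis.
From mathcomp Require Import zify lra.

Set Implicit Arguments.
Unset Strict Implicit.
Unset Printing Implicit Defensive.

Import Order.TTheory GRing.Theory Num.Theory.

Local Open Scope nat_scope.

(** * Computable functions and bounded evaluation *)

Notation "x .|1" := (nunpair x).1 (at level 2, format "x .|1").
Notation "x .|2" := (nunpair x).2 (at level 2, format "x .|2").

(** One program has to serve every oracle, so that a search built from computable functions also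
    runs with the empty oracle. *)
Definition computable (f : nat -> nat) : Prop :=
  exists c, forall O n r, peval O c n r <-> r = f n.

Lemma computable_eq (f g : nat -> nat) : f =1 g -> computable f -> computable g.
Proof. by move=> fg [c cP]; exists c => O n r; rewrite cP fg. Qed.

Lemma computable_fst (f : nat -> nat) :
  computable f -> computable (fun n => (f n).|1).
Proof.
move=> [c cP]; exists (PComp PFst c) => O n r /=; split.
  by move=> [m /cP -> ->].
by move=> ->; exists (f n) => //; apply/cP.
Qed.

Lemma computable_snd (f : nat -> nat) :
  computable f -> computable (fun n => (f n).|2).
Proof.
move=> [c cP]; exists (PComp PSnd c) => O n r /=; split.
  by move=> [m /cP -> ->].
by move=> ->; exists (f n) => //; apply/cP.
Qed.

Lemma computable_succ (f : nat -> nat) :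
  computable f -> computable (fun n => (f n).+1).
Proof.
move=> [c cP]; exists (PComp PSucc c) => O n r /=; split.
  by move=> [m /cP -> ->].
by move=> ->; exists (f n) => //; apply/cP.
Qed.

Lemma computable_pair (f g : nat -> nat) :
  computable f -> computable g -> computable (fun n => npair (f n) (g n)).
Proof.
move=> [c cP] [b bP]; exists (PPair c b) => O n r /=; split.
  by move=> [? [? [/cP -> /bP -> ->]]].
by move=> ->; exists (f n), (g n); split => //; [exact/cP|exact/bP].
Qed.

Lemma computable_id : computable (fun n => n).
Proof.
exists (PPair PFst PSnd) => O n r /=; split.
  by move=> [? [? [-> -> ->]]]; rewrite nunpairK.
by move=> ->; exists n.|1, n.|2; split; rewrite ?nunpairK.
Qed.

Lemma computable_const (k : nat) : computable (fun=> k).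
Proof. by elim: k => [|k /computable_succ //]; exists PZero. Qed.

(** [PPrec] in the form of iteration, to which arithmetic, bounded quantifiers and sums are reduced
    below. *)
Lemma computable_iteri (b a : nat -> nat) (s : nat -> nat -> nat -> nat) :
  computable b -> computable a ->
  computable (fun z => s z.|1 z.|2.|1 z.|2.|2) ->
  computable (fun n => iteri (b n) (s n) (a n)).
Proof.
move=> [cb bP] [ca aP] [cs sP].
have [ci iP] := computable_id.
exists (PComp (PPrec ca cs) (PPair ci cb)) => O n r.
have precE k z : peval O (PPrec ca cs) (npair n k) z <-> z = iteri k (s n) (a n).
  rewrite /= npairK /=; elim: k z => [|k IH] z /=; first exact: aP.
  split; first by move=> [y /IH -> /sP ->]; rewrite !npairK.
  by move=> ->; exists (iteri k (s n) (a n)); [apply/IH|apply/sP; rewrite !npairK].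
split.
  by move=> [_ [_ [_ [/iP -> /bP -> ->]]] /precE].
move=> ->; exists (npair n (b n)); last exact/precE.
by exists n, (b n); split => //; [exact/iP|exact/bP].
Qed.

Lemma computable_pred (f : nat -> nat) :
  computable f -> computable (fun n => (f n).-1).
Proof.
move=> cf; apply: (@computable_eq (fun n => iteri (f n) (fun i _ => i) 0)).
  by move=> n; case: (f n).
apply: computable_iteri => //; first exact: computable_const.
exact/computable_fst/computable_snd/computable_id.
Qed.

Lemma computable_add (f g : nat -> nat) :
  computable f -> computable g -> computable (fun n => f n + g n).
Proof.
move=> cf cg.
apply: (@computable_eq (fun n => iteri (f n) (fun _ => S) (g n))).
  by move=> n; elim: (f n) => //= k ->.
by apply: computable_iteri => //;
  exact/computable_succ/computable_snd/computable_snd/computable_id.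
Qed.

Lemma computable_sub (f g : nat -> nat) :
  computable f -> computable g -> computable (fun n => f n - g n).
Proof.
move=> cf cg.
apply: (@computable_eq (fun n => iteri (g n) (fun _ => predn) (f n))).
  by move=> n; elim: (g n) => /= [|k ->]; lia.
by apply: computable_iteri => //;
  exact/computable_pred/computable_snd/computable_snd/computable_id.
Qed.

Lemma computable_comp (f g : nat -> nat) :
  computable f -> computable g -> computable (fun n => f (g n)).
Proof.
move=> [c cP] [b bP]; exists (PComp c b) => O n r /=; split.
  by move=> [m /bP -> /cP].
by move=> ->; exists (g n); [exact/bP|exact/cP].
Qed.

Lemma computable_mul (f g : nat -> nat) :
  computable f -> computable g -> computable (fun n => f n * g n).
Proof.
move=> cf cg.
apply: (@computable_eq (fun n => iteri (f n) (fun _ x => g n + x) 0)).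
  by move=> n; elim: (f n) => //= k ->; rewrite mulSn.
apply: computable_iteri => //; first exact: computable_const.
apply: computable_add; last exact/computable_snd/computable_snd/computable_id.
exact/computable_comp/computable_fst/computable_id.
Qed.

Lemma computable_leq (f g : nat -> nat) :
  computable f -> computable g -> computable (fun n => f n <= g n).
Proof.
move=> cf cg; apply: (@computable_eq (fun n => 1 - (f n - g n))); first by move=> n; lia.
by apply: computable_sub; [exact: computable_const|exact: computable_sub].
Qed.

Lemma computable_neg (p : nat -> bool) :
  computable p -> computable (fun n => ~~ p n).
Proof.
move=> cp; apply: (@computable_eq (fun n => 1 - p n)); first by move=> n; case: (p n).
by apply: computable_sub; first exact: computable_const.
Qed.

Lemma computable_and (p q : nat -> bool) :
  computable p -> computable q -> computable (fun n => p n && q n).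
Proof.
move=> cp cq; apply: (@computable_eq (fun n => p n * q n)); first by move=> n; rewrite mulnb.
exact: computable_mul.
Qed.

Lemma computable_or (p q : nat -> bool) :
  computable p -> computable q -> computable (fun n => p n || q n).
Proof.
move=> cp cq; apply: (@computable_eq (fun n => ~~ (~~ p n && ~~ q n))).
  by move=> n; rewrite negb_and !negbK.
by apply/computable_neg/computable_and; exact: computable_neg.
Qed.

Lemma computable_eqn (f g : nat -> nat) :
  computable f -> computable g -> computable (fun n => f n == g n).
Proof.
move=> cf cg; apply: (@computable_eq (fun n => (f n <= g n) && (g n <= f n))).
  by move=> n; rewrite eqn_leq.
by apply: computable_and; exact: computable_leq.
Qed.

Lemma computable_eqb (p q : nat -> bool) :
  computable p -> computable q -> computable (fun n => p n == q n).
Proof.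
move=> cp cq; apply: (@computable_eq (fun n => (p n : nat) == q n)).
  by move=> n; case: (p n); case: (q n).
exact: computable_eqn.
Qed.

Lemma computable_all (b : nat -> nat) (p : nat -> nat -> bool) :
  computable b -> computable (fun z => p z.|1 z.|2) ->
  computable (fun n => all (p n) (iota 0 (b n))).
Proof.
move=> cb cp.
apply: (@computable_eq (fun n => iteri (b n) (fun i s => p n i * s) 1)).
  move=> n; elim: (b n) => // k IH.
  by rewrite -[in RHS]addn1 iotaD all_cat /= andbT IH mulnb andbC.
apply: computable_iteri => //; first exact: computable_const.
apply: computable_mul; last exact/computable_snd/computable_snd/computable_id.
apply: (@computable_eq
  (fun z => p (npair z.|1 z.|2.|1).|1 (npair z.|1 z.|2.|1).|2)).
  by move=> z; rewrite !npairK.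
apply: (computable_comp (g := fun z => npair z.|1 z.|2.|1) cp).
apply: computable_pair; first exact/computable_fst/computable_id.
exact/computable_fst/computable_snd/computable_id.
Qed.

Lemma computable_has (b : nat -> nat) (p : nat -> nat -> bool) :
  computable b -> computable (fun z => p z.|1 z.|2) ->
  computable (fun n => has (p n) (iota 0 (b n))).
Proof.
move=> cb cp.
apply: (@computable_eq (fun n => ~~ all (fun i => ~~ p n i) (iota 0 (b n)))).
  by move=> n; rewrite -has_predC; congr (nat_of_bool _); apply: eq_has => i /=; rewrite negbK.
by apply/computable_neg/computable_all => //; exact: computable_neg.
Qed.

Lemma computable_sum (b : nat -> nat) (s : nat -> nat -> nat) :
  computable b -> computable (fun z => s z.|1 z.|2) ->
  computable (fun n => \sum_(0 <= i < b n) s n i).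
Proof.
move=> cb cs.
apply: (@computable_eq (fun n => iteri (b n) (fun i x => x + s n i) 0)).
  by move=> n; elim: (b n) => [|k IH]; [rewrite big_geq|rewrite big_nat_recr //= IH].
apply: computable_iteri => //; first exact: computable_const.
apply: computable_add; first exact/computable_snd/computable_snd/computable_id.
apply: (@computable_eq
  (fun z => s (npair z.|1 z.|2.|1).|1 (npair z.|1 z.|2.|1).|2)).
  by move=> z; rewrite !npairK.
apply: (computable_comp (g := fun z => npair z.|1 z.|2.|1) cs).
apply: computable_pair; first exact/computable_fst/computable_id.
exact/computable_fst/computable_snd/computable_id.
Qed.

(* The syntactic match keeps unification from unfolding [npair] and [ev]. *)
Ltac computable_step := first
  [assumption | exact computable_id | exact (computable_const _) |
  lazymatch goal with
  | |- computable (fun n => (nunpair (@?f n)).1) => apply: computable_fst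
  | |- computable (fun n => (nunpair (@?f n)).2) => apply: computable_snd
  | |- computable (fun n => (@?f n).+1) => apply: computable_succ
  | |- computable (fun n => (@?f n).-1) => apply: computable_pred
  | |- computable (fun n => npair (@?f n) (@?g n)) => apply: computable_pair
  | |- computable (fun n => @?f n + @?g n) => apply: computable_add
  | |- computable (fun n => @?f n - @?g n) => apply: computable_sub
  | |- computable (fun n => @?f n * @?g n) => apply: computable_mul
  | |- computable (fun n => nat_of_bool (~~ (@?p n))) => apply: computable_neg
  | |- computable (fun n => nat_of_bool (@?p n && @?q n)) => apply: computable_and
  | |- computable (fun n => nat_of_bool (@?p n || @?q n)) => apply: computable_or
  | |- computable (fun n => nat_of_bool (@?f n <= @?g n)) => apply: computable_leq
  | |- computable (fun n => nat_of_bool (@?f n == @?g n)) =>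
      first [apply: computable_eqn | apply: computable_eqb]
  | |- computable (fun n => nat_of_bool (all (@?p n) (iota 0 (@?b n)))) =>
      apply: computable_all
  | |- computable (fun n => nat_of_bool (has (@?p n) (iota 0 (@?b n)))) =>
      apply: computable_has
  | |- computable (fun n => bigop 0 (@?r n) (@?b n)) => apply: computable_sum
  end].
Ltac computability := repeat (computable_step; cbv beta).

(** Minimization applied to the negation of [p] halts exactly when there is a witness. *)
Lemma ce_exists (p : nat -> nat -> bool) :
  computable (fun z => p z.|1 z.|2) -> ce [set n | exists w, p n w].
Proof.
move=> /computable_neg[c cP]; exists (PMu c) => n; split.
  move=> ex; exists (ex_minn ex); case: ex_minnP => m pm mP; split.
    by apply/cP; rewrite !npairK pm.
  move=> k km; exists 0; apply/cP; rewrite !npairK.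
  by have [/mP|] := boolP (p n k); rewrite // leqNgt km.
by move=> [m [/cP + _]]; rewrite !npairK => /esym/eqP; rewrite eqb0 negbK; exists m.
Qed.

(* Step-bounded evaluation with the partial oracle [look k], in which the values
   [0] and [v.+1] stand for "undefined" and "defined with value [v]"; the fuel
   [t] bounds the unbounded searches. *)
Section BoundedEvaluation.
Variable look : nat -> nat -> nat.

Fixpoint ev (c : prog) (k t n : nat) : nat :=
  match c with
  | PZero => 1
  | PSucc => n.+2
  | PFst => n.|1.+1
  | PSnd => n.|2.+1
  | POracle => look k n
  | PPair f g => (0 < ev f k t n) && (0 < ev g k t n) *
                 (npair (ev f k t n).-1 (ev g k t n).-1).+1
  | PComp f g => (0 < ev g k t n) * ev f k t (ev g k t n).-1
  | PPrec f g =>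
      iteri n.|2 (fun i y => (0 < y) * ev g k t (npair n.|1 (npair i y.-1)))
        (ev f k t n.|1)
  | PMu f =>
      \sum_(0 <= m < t) ((ev f k t (npair n m) == 1) &&
        all (fun j => 1 < ev f k t (npair n j)) (iota 0 m)) * m.+1
  end.

Lemma computable_ev (c : prog) (k t x : nat -> nat) :
  (forall f g, computable f -> computable g ->
    computable (fun n => look (f n) (g n))) ->
  computable k -> computable t -> computable x ->
  computable (fun n => ev c (k n) (t n) (x n)).
Proof.
move=> clook; elim: c k t x => [||||| f IHf g IHg | f IHf g IHg
  | f IHf g IHg | f IHf] k t x ck ct cx /=; computability.
- exact: clook.
- exact: IHf.
- exact: IHg.
- exact: IHf.
- exact: IHg.
- exact: IHg.
- by apply: IHf => //; apply: computable_pred; exact: IHg.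
- apply: computable_iteri; computability; first by apply: IHf; computability.
  by apply: IHg; computability;
    exact/(computable_comp (g := fun z => z.|1))/computable_fst/computable_id.
- by apply: IHf; computability;
    exact/(computable_comp (g := fun z => z.|1))/computable_fst/computable_id.
- by apply: IHf; computability;
    exact/(computable_comp (g := fun z => z.|1.|1))/computable_fst/computable_fst/computable_id.
Qed.

Lemma ev_sound (O : set nat) (k t : nat) :
  (forall x v, look k x = v.+1 -> peval O POracle x v) ->
  forall c n r, ev c k t n = r.+1 -> peval O c n r.
Proof.
move=> lookP; elim=> [||||| f IHf g IHg | f IHf g IHg
  | f IHf g IHg | f IHf] n r /=.
- by move=> [].
- by move=> [].
- by move=> [].
- by move=> [].
- exact: lookP.
- case Ef: (ev f k t n) => [|a] //; case Eg: (ev g k t n) => [|b] //=.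
  rewrite mul1n => -[<-].
  by exists a, b; split; [exact: IHf|exact: IHg|].
- case Eg: (ev g k t n) => [|b] //=; rewrite mul1n => Ef.
  by exists b; [exact: IHg|exact: IHf].
- elim: (n.|2) r => [|i IH] r /=; first exact: IHf.
  case Ey: (iteri _ _ _) => [|y] //=; rewrite mul1n => Eg.
  by exists y; [exact: IH|exact: IHg].
- rewrite big_mkord.
  (* At most one term of the sum is nonzero, that of the least zero: the value 1 means output 0, a
     value above 1 a positive output. *)
  have [/existsP[m mP] E|/existsPn h] := boolP [exists m : 'I_t,
    (ev f k t (npair n m) == 1) && all (fun j => 1 < ev f k t (npair n j)) (iota 0 m)].
    move: E; rewrite (bigD1 m) //= mP mul1n big1 ?addn0; last first.
      move=> j jm; case: (ltngtP j m) => jm'.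
      + have /andP[_ /allP/(_ (val j))] := mP.
        by rewrite mem_iota /= jm' => /(_ isT); case: eqP => [->|].
      + have [/andP[_ /allP/(_ (val m))]|] := boolP (_ && _) => //.
        by rewrite mem_iota /= jm' => /(_ isT); case/andP: mP => /eqP ->.
      + by move/negP: jm; case; apply/eqP/val_inj.
    move=> [<-]; have /andP[/eqP m1 /allP mall] := mP; split; first exact: IHf.
    move=> j jm; have := mall j; rewrite mem_iota /= jm => /(_ isT).
    by case Ej: ev => [|[|v]] // _; exists v; exact: IHf.
  by rewrite big1 // => j _; rewrite (negbTE (h j)).
Qed.

(** A halting computation makes finitely many oracle queries and finitely many searches; [B] bounds
    the queries and suffices as fuel. *)
Lemma ev_complete (O : set nat) (c : prog) (n r : nat) :
  peval O c n r -> exists B, forall k t, B <= t ->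
    (forall x v, x < B -> peval O POracle x v -> look k x = v.+1) ->
    ev c k t n = r.+1.
Proof.
elim: c n r => [||||| f IHf g IHg | f IHf g IHg
  | f IHf g IHg | f IHf] n r /=.
- by move=> ->; exists 0.
- by move=> ->; exists 0.
- by move=> ->; exists 0.
- by move=> ->; exists 0.
- by move=> h; exists n.+1 => k t _; exact.
- move=> [a [b [/IHf[B1 h1] /IHg[B2 h2] ->]]]; exists (B1 + B2) => k t Bt hk.
  rewrite (h1 k t) ?(h2 k t) ?mul1n //; try lia;
    by move=> x v xB; apply: hk; lia.
- move=> [b /IHg[B2 h2] /IHf[B1 h1]]; exists (B1 + B2) => k t Bt hk.
  rewrite (h2 k t) /= ?(h1 k t) ?mul1n //; try lia;
    by move=> x v xB; apply: hk; lia.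
- elim: (n.|2) r => [|i IH] r /=; first exact: IHf.
  move=> [y /IH[B1 h1] /IHg[B2 h2]]; exists (B1 + B2) => k t Bt hk.
  rewrite (h1 k t) /= ?(h2 k t) ?mul1n //; try lia;
    by move=> x v xB; apply: hk; lia.
- move=> [/IHf[B1 h1] hr].
  have [B2 h2] : exists B, forall k t, B <= t ->
      (forall x v, x < B -> peval O POracle x v -> look k x = v.+1) ->
      forall j, j < r -> 1 < ev f k t (npair n j).
    elim: r hr {h1} => [|r IH] hr; first by exists 0.
    have [B3 h3] := IH (fun j jr => hr j (ltnW jr)).
    have [v /IHf[B4 h4]] := hr r (leqnn _).
    exists (B3 + B4) => k t Bt hk j; rewrite ltnS leq_eqVlt => /predU1P[->|jr].
      by rewrite (h4 k t) //; [lia|move=> x w xB; apply: hk; lia].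
    by apply: h3 => //; [lia|move=> x w xB; apply: hk; lia].
  exists (B1 + B2 + r.+1) => k t Bt hk.
  have rt : r < t by lia.
  have er : ev f k t (npair n r) = 1.
    by apply: h1; [lia|move=> x w xB; apply: hk; lia].
  have ej j : j < r -> 1 < ev f k t (npair n j).
    by apply: h2; [lia|move=> x w xB; apply: hk; lia].
  rewrite big_mkord (bigD1 (Ordinal rt)) //= er eqxx /=.
  have -> : all (fun j => 1 < ev f k t (npair n j)) (iota 0 r).
    by apply/allP => j; rewrite mem_iota /=; exact: ej.
  rewrite mul1n big1 ?addn0 // => j /eqP jr.
  case: (ltngtP j r) => jr'.
  + by case: eqP (ej _ jr') => [->|].
  + have [/andP[_ /allP/(_ r)]|] := boolP (_ && _) => //.
    by rewrite mem_iota /= jr' er => /(_ isT).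
  + by case: jr; exact: val_inj.
Qed.

End BoundedEvaluation.

(** * Codes of finite rational metrics *)

Lemma le_npair (a b : nat) : (a <= npair a b) /\ (b <= npair a b).
Proof.
by have := Stdlib.Arith.Cantor.to_nat_non_decreasing a b; rewrite /npair; lia.
Qed.

Lemma nunpair_le (n : nat) : (n.|1 <= n) /\ (n.|2 <= n).
Proof. by have := le_npair n.|1 n.|2; rewrite nunpairK. Qed.

(** Iterated unpairing reads every number as an infinite list, so that there are no ill-formed
    codes. *)
Definition dec (k i : nat) : nat := (iter i (fun x => x.|2) k).|1.

Lemma computable_dec (f g : nat -> nat) :
  computable f -> computable g -> computable (fun n => dec (f n) (g n)).
Proof.
move=> cf cg; apply/computable_fst.
apply: (@computable_eq (fun n => iteri (g n) (fun _ x => x.|2) (f n))).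
  by move=> n; elim: (g n) => //= i ->.
by apply: computable_iteri => //; computability.
Qed.

Lemma dec_surj (f : nat -> nat) (T : nat) :
  exists k, forall i, i < T -> dec k i = f i.
Proof.
elim: T f => [|T IH] f; first by exists 0.
have [k kP] := IH (fun i => f i.+1).
exists (npair (f 0) k) => -[|i] iT; first by rewrite /dec /= npairK.
by rewrite /dec iterSr npairK; exact: kP.
Qed.

(* [k] codes a square matrix of size [msize k] with the nonnegative rational
   entries [ment k i j / mden k]. *)
Definition msize (k : nat) : nat := k.|1.
Definition mden (k : nat) : nat := k.|2.|1.+1.
Definition ment (k i j : nat) : nat := dec k.|2.|2 (npair i j).

Lemma computable_msize (f : nat -> nat) :
  computable f -> computable (fun n => msize (f n)).
Proof. by move=> cf; rewrite /msize; computability. Qed.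

Lemma computable_mden (f : nat -> nat) :
  computable f -> computable (fun n => mden (f n)).
Proof. by move=> cf; rewrite /mden; computability. Qed.

Lemma computable_ment (f g h : nat -> nat) :
  computable f -> computable g -> computable h ->
  computable (fun n => ment (f n) (g n) (h n)).
Proof. by move=> cf cg ch; apply: computable_dec; computability. Qed.

(** With a, b, c the parts of [p] and [D] positive, this is (a - b) / (c + 1) < N / D,
    cross-multiplied so that only natural numbers occur; [lt_code] is analogous. *)
Definition code_lt (p N D : nat) : bool :=
  p.|1 * D < N * p.|2.|2.+1 + p.|2.|1 * D.
Definition lt_code (N D q : nat) : bool :=
  N * q.|2.|2.+1 + q.|2.|1 * D < q.|1 * D.

(** A query about an index outside the matrix is undefined, so a computation that succeeds with [k]
    depends on the matrix alone. *)
Definition look (k x : nat) : nat :=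
  ((x.|1.|1 < msize k) && (x.|1.|2 < msize k)) *
  (code_lt x.|2.|1 (ment k x.|1.|1 x.|1.|2) (mden k) &&
   lt_code (ment k x.|1.|1 x.|1.|2) (mden k) x.|2.|2).+1.

Ltac matrix_step := lazymatch goal with
  | |- computable (fun n => msize (@?f n)) => apply: computable_msize
  | |- computable (fun n => mden (@?f n)) => apply: computable_mden
  | |- computable (fun n => ment (@?f n) (@?i n) (@?j n)) => apply: computable_ment
  | |- computable (fun n => dec (@?f n) (@?i n)) => apply: computable_dec
  | |- _ => computable_step
  end.
Ltac matrix_computability := repeat (matrix_step; cbv beta).

Lemma computable_look (f g : nat -> nat) :
  computable f -> computable g -> computable (fun n => look (f n) (g n)).
Proof.
by move=> cf cg; rewrite /look /code_lt /lt_code; matrix_computability.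
Qed.

(* [k] codes a metric which extends the matrix coded by [o] and in which every
   new point is at distance less than [1 / T.+1] from an old one flagged by
   [fl]. *)
Definition extension (o fl T k : nat) : bool :=
  [&& msize o <= msize k,
      all (fun i => all (fun j => ment k i j * mden o == ment o i j * mden k)
        (iota 0 (msize o))) (iota 0 (msize o)),
      all (fun i => all (fun j =>
          [&& (ment k i j == 0) == (i == j), ment k i j == ment k j i &
              all (fun l => ment k i l <= ment k i j + ment k j l)
                (iota 0 (msize k))])
        (iota 0 (msize k))) (iota 0 (msize k)) &
      all (fun i => (i < msize o) ||
          has (fun u => (0 < dec fl u) && (ment k i u * T.+1 < mden k))
            (iota 0 (msize o)))
        (iota 0 (msize k))].

Lemma computable_extension (o fl T : nat) (f : nat -> nat) :
  computable f -> computable (fun n => extension o fl T (f n)).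
Proof.
move=> cf; suff : computable (fun k => extension o fl T k).
  by move=> /computable_comp; exact.
have cm : computable msize := computable_msize computable_id.
by rewrite /extension; matrix_computability.
Qed.

(** A witness packs a matrix code and an amount of fuel, so that one unbounded search runs over
    both. *)
Lemma ce_search (p : nat -> bool) (c : prog) :
  (forall f, computable f -> computable (fun n => p (f n))) ->
  ce [set n | exists w, p w.|1 && (0 < ev look c w.|1 w.|2 n)].
Proof.
move=> cp.
apply: (@ce_exists (fun n w => p w.|1 && (0 < ev look c w.|1 w.|2 n))).
computability; first by apply: cp; computability.
by apply: computable_ev; [exact: computable_look| | | ]; computability.
Qed.

Section CodedMatrices.
Context {R : realType}.
Local Open Scope ring_scope.

Definition nnrat (x : R) : Prop := exists N C : nat, x = N%:R / C.+1%:R.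

Definition mval (k i j : nat) : R := (ment k i j)%:R / (mden k)%:R.

Definition agrees (d : nat -> nat -> R) (k : nat) : Prop :=
  forall i j, (i < msize k)%N -> (j < msize k)%N -> d i j = mval k i j.

Lemma nnrat_common_den (f : nat -> R) (T : nat) : (forall i, nnrat (f i)) ->
  exists C, forall i, (i < T)%N -> exists N : nat, f i = N%:R / C.+1%:R.
Proof.
move=> rf; elim: T => [|T [C IH]]; first by exists 0%N.
have [N [D fT]] := rf T.
have den_eq (a b : nat) : (a.+1 * b.+1).-1.+1%:R = a.+1%:R * b.+1%:R :> R.
  by rewrite -natrM; congr (_%:R); lia.
have nz (a : nat) : a.+1%:R != 0 :> R by rewrite pnatr_eq0.
exists (C.+1 * D.+1).-1 => i; rewrite ltnS leq_eqVlt => /predU1P[->|/IH[M ->]].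
  by exists (N * C.+1)%N; rewrite fT den_eq natrM (mulrC C.+1%:R) -mulf_div divff // mulr1.
by exists (M * D.+1)%N; rewrite den_eq natrM -mulf_div divff // mulr1.
Qed.

Lemma code_exists (d : nat -> nat -> R) (m : nat) :
  (forall i j, nnrat (d i j)) -> exists2 k, msize k = m & agrees d k.
Proof.
move=> rd.
(* [B] exceeds the codes of all index pairs below [m], so a list with [B] prescribed entries holds
   the whole matrix over a common denominator. *)
have [B BP] : exists B, forall i j, (i < m -> j < m -> npair i j < B)%N.
  exists (\sum_(0 <= i < m) \sum_(0 <= j < m) (npair i j).+1)%N => i j im jm.
  rewrite (bigD1_seq i) ?mem_index_iota ?iota_uniq //=.
  by rewrite (bigD1_seq j) ?mem_index_iota ?iota_uniq //=; lia.
have [C CP] := nnrat_common_den B (fun x => rd x.|1 x.|2).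
have /choice[N NP] : forall x, exists N : nat, (x < B)%N -> d x.|1 x.|2 = N%:R / C.+1%:R.
  move=> x; have [/CP[N ->]|] := boolP (x < B)%N; first by exists N.
  by exists 0%N.
have [w wP] := dec_surj N B.
exists (npair m (npair C w)); rewrite /agrees /msize !npairK //= => i j im jm.
have ijB := BP _ _ im jm.
by rewrite /mval /ment /mden !npairK /= wP // -NP // npairK.
Qed.

Lemma mden_gt0 (k : nat) : 0 < (mden k)%:R :> R.
Proof. by rewrite ltr0n. Qed.

Lemma mval_nnrat (k i j : nat) : nnrat (mval k i j).
Proof. by exists (ment k i j), k.|2.|1. Qed.

Lemma ratr_code (p : nat) :
  ratr (rat_of_code p) = (p.|1%:R - p.|2.|1%:R) / p.|2.|2.+1%:R :> R.
Proof.
rewrite /rat_of_code; case: (nunpair p) => a m /=; case: (nunpair m) => b c /=.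
by rewrite fmorph_div rmorphB /= !ratr_nat.
Qed.

Lemma code_ltE (p N D : nat) :
  code_lt p N D.+1 = (ratr (rat_of_code p) < N%:R / D.+1%:R :> R).
Proof.
rewrite ratr_code ltr_pdivlMr ?ltr0n // mulrAC ltr_pdivrMr ?ltr0n //.
by rewrite mulrBl ltrBlDr -!natrM -natrD ltr_nat.
Qed.

Lemma lt_codeE (q N D : nat) :
  lt_code N D.+1 q = (N%:R / D.+1%:R < ratr (rat_of_code q) :> R).
Proof.
rewrite ratr_code ltr_pdivrMr ?ltr0n // mulrAC ltr_pdivlMr ?ltr0n //.
by rewrite mulrBl ltrBrDr -!natrM -natrD ltr_nat.
Qed.

Lemma metric_oracleE (d : nat -> nat -> R) (x : nat) :
  metric_oracle d x <->
  ratr (rat_of_code x.|2.|1) < d x.|1.|1 x.|1.|2 < ratr (rat_of_code x.|2.|2).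
Proof.
rewrite /metric_oracle /=; case: (nunpair x) => a b /=.
by case: (nunpair a) => i j; case: (nunpair b).
Qed.

Lemma lookE (d : nat -> nat -> R) (k x v : nat) : agrees d k ->
  (x.|1.|1 < msize k)%N -> (x.|1.|2 < msize k)%N ->
  look k x = v.+1 <-> peval (metric_oracle d) POracle x v.
Proof.
move=> dk im jm; rewrite /look im jm /= mul1n.
have /propext -> := metric_oracleE d x.
rewrite dk // /mval code_ltE lt_codeE; case: (_ && _) => /=.
  by split; [move=> [<-]; left|case=> -[] // _ ->].
by split; [move=> [<-]; right|case=> -[] // _ ->].
Qed.

Lemma halts_of_code (d : nat -> nat -> R) (c : prog) (k t n : nat) :
  agrees d k -> (0 < ev look c k t n)%N ->
  exists r, peval (metric_oracle d) c n r.
Proof.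
move=> dk; case E: ev => [|r] // _; exists r; apply: ev_sound E => x v lk.
apply/lookE; [exact: dk| | |exact: lk]; by move: lk; rewrite /look;
  case: (x.|1.|1 < _)%N; case: (x.|1.|2 < _)%N.
Qed.

Lemma code_of_halts (d : nat -> nat -> R) (c : prog) (n r : nat) :
  peval (metric_oracle d) c n r -> exists m, forall k, (m <= msize k)%N ->
  agrees d k -> exists t, (0 < ev look c k t n)%N.
Proof.
(* Unpairing does not increase numbers, so a query below [B] mentions only indices below [B], and a
   matrix of size [B] answers it. *)
move=> /(ev_complete look)[B BP]; exists B => k Bk dk; exists B.
rewrite (BP k B) // => x v xB; apply: (iffRL (lookE _ dk _ _)).
  by have := nunpair_le x.|1; have := nunpair_le x; lia.
by have := nunpair_le x.|1; have := nunpair_le x; lia.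
Qed.

Definition finite_metric (m : nat) (d : nat -> nat -> R) : Prop :=
  forall i j, (i < m)%N -> (j < m)%N ->
    [/\ (d i j = 0 <-> i = j), d i j = d j i &
        forall l, (l < m)%N -> d i l <= d i j + d j l].

Lemma extensionP (o fl T k : nat) :
  extension o fl T k <->
  [/\ (msize o <= msize k)%N, agrees (mval k) o, finite_metric (msize k) (mval k) &
      forall i, (msize o <= i < msize k)%N -> exists u,
        [/\ (u < msize o)%N, (0 < dec fl u)%N & mval k i u < T.+1%:R^-1]].
Proof.
have nz a : (mden a)%:R != 0 :> R by rewrite pnatr_eq0.
rewrite /extension; split.
  move=> /and4P[ok /allP h1 /allP h2 /allP h3]; split => //.
  - move=> i j io jo; have := h1 i; rewrite mem_iota /= => /(_ io)/allP/(_ j).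
    rewrite mem_iota => /(_ jo)/eqP/(congr1 (fun x => x%:R : R)).
    by rewrite !natrM /mval => E; apply/eqP; rewrite eqr_div // E.
  - move=> i j ik jk; have := h2 i; rewrite mem_iota /= => /(_ ik)/allP/(_ j).
    rewrite mem_iota => /(_ jk)/and3P[/eqP zE /eqP sE /allP tr].
    rewrite /mval; split; first 1 last.
    + by rewrite sE.
    + move=> l lk; have := tr l; rewrite mem_iota => /(_ lk).
      by rewrite -mulrDl ler_pM2r ?invr_gt0 ?mden_gt0 // -natrD ler_nat.
    + split=> [/eqP|/eqP ij].
        by rewrite mulf_eq0 invr_eq0 (negbTE (nz k)) orbF pnatr_eq0 zE => /eqP.
      by move: zE; rewrite ij => /eqP ->; rewrite mul0r.
  - move=> i /andP[oi ik]; have := h3 i; rewrite mem_iota /= => /(_ ik).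
    rewrite ltnNge oi /= => /hasP[u]; rewrite mem_iota /= => uo /andP[fu hu].
    exists u; split => //; rewrite /mval -[T.+1%:R^-1]mul1r ltr_pdivlMr ?ltr0n // mulrAC.
    by rewrite ltr_pdivrMr ?mden_gt0 // mul1r -natrM ltr_nat.
move=> [ok h1 h2 h3]; apply/and4P; split => //.
- apply/allP => i; rewrite mem_iota /= => io; apply/allP => j; rewrite mem_iota /= => jo.
  have /eqP := h1 _ _ io jo; rewrite /mval eqr_div // -!natrM eqr_nat.
  by [].
- apply/allP => i; rewrite mem_iota /= => ik; apply/allP => j; rewrite mem_iota /= => jk.
  have [zE sE tr] := h2 _ _ ik jk; apply/and3P; split.
  + apply/eqP; apply/idP/idP => /eqP E; apply/eqP.
      by apply/zE; rewrite /mval E mul0r.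
    move/zE: E => /eqP; rewrite mulf_eq0 invr_eq0 (negbTE (nz k)) orbF pnatr_eq0.
    by move=> /eqP.
  + move: sE => /eqP; rewrite /mval eqr_div // -!natrM eqr_nat.
    by rewrite eqn_pmul2r.
  + apply/allP => l; rewrite mem_iota /= => lk; move: (tr l lk).
    by rewrite /mval -mulrDl ler_pM2r ?invr_gt0 ?mden_gt0 // -natrD ler_nat.
- apply/allP => i; rewrite mem_iota /= => ik.
  have [//|oi] := ltnP i (msize o) => /=.
  have [|u [uo fu]] := h3 i; first by rewrite oi.
  rewrite /mval -[T.+1%:R^-1]mul1r ltr_pdivlMr ?ltr0n // mulrAC.
  rewrite ltr_pdivrMr ?mden_gt0 // mul1r -natrM ltr_nat => hu.
  by apply/hasP; exists u; rewrite ?mem_iota // fu.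
Qed.

(** If neither case occurred for any [n], then [A] would be the set of numbers on which some coded
    extension makes [c] halt, and that set is c.e. *)
Lemma not_ce_extension (A : set nat) (c : prog) (o fl T : nat) : ~ ce A ->
  exists n,
    (~ A n /\ exists k t, extension o fl T k /\ (0 < ev look c k t n)%N) \/
    (A n /\ forall k t, extension o fl T k -> ev look c k t n = 0%N).
Proof.
move=> nA; apply: contrapT => /forallNP h; apply: nA.
have /ce_search := @computable_extension o fl T => /(_ c).
congr ce; apply/seteqP; split=> n /=.
  move=> [w /andP[ew hw]]; apply: contrapT => An; apply: (h n); left.
  by split => //; exists w.|1, w.|2.
move=> An; apply: contrapT => hn; apply: (h n); right; split => // k t ek.
apply/eqP; rewrite -leqn0 leqNgt; apply/negP => hk; apply: hn.
by exists (npair k t); rewrite !npairK ek.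
Qed.

(* A space of [K.+1] points is presented on all of [nat] by repeating the last
   point. *)
Definition discrete_dist (K i j : nat) : nat := minn i K != minn j K.

(** The matrices of the discrete metric form a decidable set, so a search through them replaces the
    oracle. *)
Lemma ce_discrete (K : nat) (A : set nat) :
  ce_rel_metric (fun i j => (discrete_dist K i j)%:R : R) A -> ce A.
Proof.
move=> [c cP].
pose p k := all (fun i => all (fun j =>
  ment k i j == discrete_dist K i j * mden k)%N (iota 0 (msize k)))
  (iota 0 (msize k)).
have cp f : computable f -> computable (fun n => p (f n)).
  suff : computable (fun k => p k) by move=> h cf; exact: (computable_comp h cf).
  rewrite /p /discrete_dist.
  have minE i : minn i K = (i - (i - K))%N by lia.
  apply: (@computable_eq (fun k => all (fun i => all (fun j => ment k i j ==
     (i - (i - K) != j - (j - K)) * mden k)%N (iota 0 (msize k))) (iota 0 (msize k)))).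
    move=> k; congr nat_of_bool; apply: eq_all => i; apply: eq_all => j.
    by rewrite !minE.
  have cm : computable msize := computable_msize computable_id.
  by matrix_computability.
have pP k : p k <-> agrees (fun i j => (discrete_dist K i j)%:R) k.
  have nz : (mden k)%:R != 0 :> R by rewrite pnatr_eq0.
  have E i j : (ment k i j == discrete_dist K i j * mden k)%N <->
      (discrete_dist K i j)%:R = mval k i j :> R.
    rewrite -(eqr_nat R) natrM /mval; split=> [/eqP ->|->]; first by rewrite mulfK.
    by rewrite divfK.
  split=> [/allP h i j ik jk|h].
    by apply/E; have := h i; rewrite mem_iota /= => /(_ ik)/allP/(_ j); rewrite mem_iota; exact.
  apply/allP => i; rewrite mem_iota /= => ik; apply/allP => j; rewrite mem_iota /= => jk.
  by apply/E; exact: h.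
have := ce_search c cp; congr ce; apply/seteqP; split=> n /=.
  by move=> [w /andP[/pP pw hw]]; apply/cP; exact: halts_of_code hw.
move=> /cP[r /code_of_halts[m mP]].
have [k km dk] : exists2 k, msize k = m &
    agrees (fun i j => (discrete_dist K i j)%:R) k.
  by apply: code_exists => i j; exists (discrete_dist K i j), 0%N; rewrite divr1.
have [t ht] := mP k (eq_leq (esym km)) dk.
by exists (npair k t); rewrite !npairK ht andbT; exact/pP.
Qed.

End CodedMatrices.

(** * Perturbation of metrics *)

Section FiniteBounds.
Context {R : realType} {U : eqType}.
Local Open Scope ring_scope.

Lemma seq_lower_bound {V : eqType} (l : seq V) (F : V -> R) :
  (forall x, x \in l -> 0 < F x) ->
  exists2 m, 0 < m & forall x, x \in l -> m <= F x.
Proof.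
elim: l => [|a l IH] h; first by exists 1.
have [|m m0 mP] := IH; first by move=> x xl; apply: h; rewrite inE xl orbT.
exists (Num.min (F a) m); first by rewrite lt_min m0 h // mem_head.
move=> x; rewrite inE => /predU1P[->|/mP mx]; first by rewrite ge_min lexx.
by rewrite ge_min mx orbT.
Qed.

Lemma seq_upper_bound {V : eqType} (l : seq V) (F : V -> R) :
  exists2 m, 0 < m & forall x, x \in l -> F x <= m.
Proof.
elim: l => [|a l [m m0 mP]]; first by exists 1.
exists (Num.max (F a) m); first by rewrite lt_max m0 orbT.
move=> x; rewrite inE => /predU1P[->|/mP mx]; first by rewrite le_max lexx.
by rewrite le_max mx orbT.
Qed.

Lemma pair_lower_bound (l : seq U) (F : U -> U -> R) :
  (forall x y, x \in l -> y \in l -> x <> y -> 0 < F x y) ->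
  exists2 m, 0 < m & forall x y, x \in l -> y \in l -> x <> y -> m <= F x y.
Proof.
move=> h.
have [|m m0 mP] := seq_lower_bound (l := [seq p <- allpairs pair l l | p.1 != p.2])
  (F := fun p => F p.1 p.2).
  move=> p; rewrite mem_filter => /andP[/eqP p12 /allpairsP[q [ql1 ql2 pq]]].
  by subst p; apply: h.
exists m => // x y xl yl /eqP xy; apply: (mP (x, y)).
by rewrite mem_filter xy; apply/allpairsP; exists (x, y).
Qed.

Lemma pair_upper_bound (l : seq U) (F : U -> U -> R) :
  exists2 m, 0 < m & forall x y, x \in l -> y \in l -> F x y <= m.
Proof.
have [m m0 mP] := seq_upper_bound (allpairs pair l l) (fun p => F p.1 p.2).
exists m => // x y xl yl; apply: (mP (x, y)).
by apply/allpairsP; exists (x, y).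
Qed.

End FiniteBounds.

Lemma exists_inv_lt {R : realType} (t : R) : (0 < t -> exists K : nat, K.+1%:R^-1 < t)%R.
Proof.
move=> t0; exists (Num.trunc t^-1).
have /andP[_ h] : ((Num.trunc t^-1)%:R <= t^-1 < (Num.trunc t^-1).+1%:R)%R.
  by apply: truncn_itv; rewrite invr_ge0 ltW.
by rewrite invf_plt ?posrE ?ltr0n.
Qed.

Section MetricPerturbation.
Context {R : realType} {T : metricType R}.
Local Open Scope ring_scope.
Implicit Types (e D : T -> T -> R) (xs ys : seq T).

(** The constants may worsen from stage to stage; their existence lets each stage translate upper
    and lower bounds on [mdist] into bounds on [e]. *)
Definition bilipschitz_metric e : Prop :=
  [/\ metric_on e,
      exists2 s, 0 < s & forall x y, s * mdist x y <= e x y &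
      exists2 L, 0 < L & forall x y, e x y <= L * mdist x y].

Definition metric_in xs D : Prop :=
  forall x y, x \in xs -> y \in xs ->
    [/\ (D x y = 0 <-> x = y), D x y = D y x &
        forall z, z \in xs -> D x z <= D x y + D y z].

Lemma metric_on_ge0 e x y : metric_on e -> 0 <= e x y.
Proof.
by move=> [[e0 es et] _]; have := et x y x; rewrite e0 (es y x); lra.
Qed.

Lemma metric_on_gt0 e x y : metric_on e -> x <> y -> 0 < e x y.
Proof.
move=> em xy; rewrite lt_neqAle (metric_on_ge0 _ _ em) andbT.
by apply/eqP => /esym; case: em => _ sep /sep.
Qed.

Lemma metric_in_gt0 xs D x y : metric_in xs D -> x \in xs -> y \in xs ->
  x <> y -> 0 < D x y.
Proof.
move=> Dm xx yx xy; have [z s t] := Dm _ _ xx yx; have := t _ xx.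
have [[_ ->] // _ _] := Dm _ _ xx xx; rewrite -s => h.
by rewrite lt_neqAle; apply/andP; split; [apply/eqP => /esym/z|lra].
Qed.

(** McShane's extension, cut off at [eps]. If [m] bounds the distances between distinct points of
    [xs] from below, any [v] bounded by [eps] is Lipschitz on [xs] with constant [2 * eps / m], so
    [L] does not depend on [v]. *)
Lemma lipschitz_extension e xs (eps : R) : metric_on e -> 0 < eps ->
  exists2 L, 0 < L & forall v : T -> R,
    (forall x, x \in xs -> `|v x| <= eps) ->
    exists g : T -> R, [/\ forall x, x \in xs -> g x = v x,
      forall x, `|g x| <= eps & forall x y, `|g x - g y| <= L * e x y].
Proof.
move=> em eps0; have [[e0 es et] _] := em.
have ege0 x y := metric_on_ge0 x y em.
have [|m m0 mP] := @pair_lower_bound R T xs e.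
  by move=> x y _ _; exact: metric_on_gt0.
exists (2 * eps / m); first by rewrite !mulr_gt0 ?invr_gt0.
set L := 2 * eps / m; move=> v vP.
have L0 : 0 < L by rewrite !mulr_gt0 ?invr_gt0.
pose g x := \big[Num.min/eps]_(z <- xs) (v z + L * e z x).
have g_eps x : g x <= eps by exact: bigmin_le_id.
have g_le x z : z \in xs -> g x <= v z + L * e z x.
  by rewrite /g; elim: xs {mP vP g g_eps} => // a l IH;
    rewrite inE big_cons => /predU1P[->|/IH h]; rewrite ge_min ?lexx // h orbT.
have le_g x a : a <= eps -> (forall z, z \in xs -> a <= v z + L * e z x) -> a <= g x.
  by move=> ae h; rewrite /g big_seq; apply: le_bigmin.
have g_lip x y : g x <= g y + L * e x y.
  rewrite -lerBlDr; apply: le_g.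
    have := g_eps x; have : 0 <= L * e x y by rewrite mulr_ge0 // ltW.
    lra.
  move=> z zx; have := g_le x _ zx; have := et z y x.
  rewrite (es y x) => /(ler_wpM2l (ltW L0)); lra.
exists g; split.
- move=> x xx; apply/eqP; rewrite eq_le; apply/andP; split.
    by have := g_le x _ xx; rewrite e0 mulr0 addr0.
  apply: le_g; first by have := vP _ xx; rewrite ler_norml => /andP[].
  move=> z zx; have [->|/eqP zx'] := eqVneq z x; first by rewrite e0 mulr0 addr0.
  have : L * m <= L * e z x by rewrite ler_pM2l // mP.
  rewrite /L divfK ?gt_eqF //.
  by have := vP _ xx; have := vP _ zx; rewrite !ler_norml; lra.
- move=> x; rewrite ler_norml g_eps andbT; apply: le_g; first by lra.
  move=> z zx; have := vP _ zx; rewrite ler_norml.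
  have : 0 <= L * e z x by rewrite mulr_ge0 // ltW.
  lra.
- by move=> x y; rewrite ler_norml; have := g_lip x y; have := g_lip y x; rewrite (es y x); lra.
Qed.

(* The distances to the points of [xs] are corrected so that they take the
   values [D] on [xs]; the term [s * e] makes the result a metric, and since [xs]
   is an [eps]-net these distances determine [e] up to a multiple of [eps]. *)
Lemma metric_amalgam e xs D (eps : R) :
  bilipschitz_metric e -> 0 < eps -> metric_in xs D ->
  (forall x y, x \in xs -> y \in xs -> `|D x y - e x y| <= eps) ->
  (forall x, exists2 z, z \in xs & e x z <= eps) ->
  exists e', [/\ bilipschitz_metric e',
    forall x y, x \in xs -> y \in xs -> e' x y = D x y &
    forall x y, `|e' x y - e x y| <= 4 * eps].
Proof.
move=> [em [sg sg0 sgP] [Lm Lm0 LmP]] eps0 Dm De net.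
have [[e0 es et] _] := em; have ege0 x y := metric_on_ge0 x y em.
have [L L0 LP] := lipschitz_extension xs em eps0.
(* [g z] extends the error [D z - e z] from [xs] to all points, still bounded by [eps]; then [f z]
   is the corrected distance to [z]. *)
have /choice[g gP] : forall z, exists gz : T -> R, z \in xs ->
    [/\ forall x, x \in xs -> gz x = D z x - e z x,
      forall x, `|gz x| <= eps & forall x y, `|gz x - gz y| <= L * e x y].
  move=> z; have [zx|_] := boolP (z \in xs); last by exists (fun=> 0).
  have [|gz gzP] := LP (fun x => D z x - e z x); first by move=> x; exact: De.
  by exists gz.
pose f z x := e z x + g z x.
have f_D z x : z \in xs -> x \in xs -> f z x = D z x.
  by move=> zx xx; rewrite /f; have [-> //] := gP _ zx; lra.
have f_lip z x y : z \in xs -> `|f z x - f z y| <= (1 + L) * e x y.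
  move=> zx; have [_ _ /(_ x y)] := gP _ zx; rewrite /f !ler_norml mulrDl mul1r.
  by have := et z x y; have := et z y x; rewrite (es y x); lra.
have f_near z x y : z \in xs -> `|f z x - f z y| <= e x y + 2 * eps.
  move=> zx; have [_ h _] := gP _ zx; move: (h x) (h y); rewrite /f !ler_norml.
  by have := et z x y; have := et z y x; rewrite (es y x); lra.
(* The sup distance between the vectors of corrected distances, hence a pseudometric. *)
pose F x y := \big[Num.max/0]_(z <- xs) `|f z x - f z y|.
have le_F x y z : z \in xs -> `|f z x - f z y| <= F x y.
  rewrite /F; elim: (xs) => // a l IH.
  by rewrite inE big_cons => /predU1P[->|/IH h]; rewrite le_max ?lexx // h orbT.
have F_le x y a : 0 <= a -> (forall z, z \in xs -> `|f z x - f z y| <= a) -> F x y <= a.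
  by move=> a0 h; rewrite /F big_seq; apply: bigmax_le.
have F_ge0 x y : 0 <= F x y by exact: bigmax_ge_id.
have [|mD mD0 mDP] := @pair_lower_bound R T xs D.
  by move=> x y xx yx; exact: metric_in_gt0 Dm xx yx.
have [M M0 MP] := @pair_upper_bound R T xs e.
(* So small that [s * e] stays below [D] on [xs] and does not disturb the prescribed values. *)
pose s := Num.min 1 (mD / M).
have s0 : 0 < s by rewrite lt_min ltr01 divr_gt0.
have s1 : s <= 1 by rewrite ge_min lexx.
have sD x y : x \in xs -> y \in xs -> s * e x y <= D x y.
  move=> xx yx; have [->|/eqP xy] := eqVneq x y.
    by rewrite e0 mulr0; have [[_ ->]] := Dm _ _ yx yx.
  apply: le_trans (mDP _ _ xx yx xy).
  have -> : mD = mD / M * M by rewrite divfK ?gt_eqF.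
  by apply: ler_pM => //; [exact: ltW|rewrite ge_min lexx orbT|exact: MP].
pose e' x y := Num.max (s * e x y) (F x y).
have e'_le x y a : s * e x y <= a -> F x y <= a -> e' x y <= a.
  by move=> h1 h2; rewrite ge_max h1.
have se_le x y : s * e x y <= e' x y by rewrite le_max lexx.
have F_e' x y : F x y <= e' x y by rewrite le_max lexx orbT.
exists e'; split.
- split; first split; first split.
  + move=> x; apply/eqP; rewrite eq_le; apply/andP; split.
      by apply: e'_le; [rewrite e0 mulr0|apply: F_le => // z _; rewrite subrr normr0].
    by apply: le_trans (F_e' _ _).
  + move=> x y; rewrite /e' es; congr Num.max.
    by rewrite /F; apply: eq_bigr => z _; rewrite distrC.
  + move=> x y z; apply: e'_le.
      apply: le_trans (lerD (se_le x y) (se_le y z)).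
      by rewrite -mulrDr ler_pM2l.
    apply: F_le => [|w wx]; first by rewrite addr_ge0 // (le_trans _ (F_e' _ _)).
    apply: le_trans (lerD (le_trans (le_F x y w wx) (F_e' _ _))
      (le_trans (le_F y z w wx) (F_e' _ _))).
    by rewrite (le_trans _ (ler_normD _ _)) // addrA subrK.
  + move=> x y xy; apply: contrapT => /(metric_on_gt0 em) h.
    by have := se_le x y; rewrite xy leNgt mulr_gt0.
  + exists (s * sg); first by rewrite mulr_gt0.
    by move=> x y; apply: le_trans (se_le _ _); rewrite -mulrA ler_pM2l.
  + exists ((1 + L) * Lm); first by rewrite mulr_gt0 // addr_gt0.
    move=> x y; have h : (1 + L) * e x y <= (1 + L) * Lm * mdist x y.
      by rewrite -mulrA ler_wpM2l // addr_ge0 // ltW.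
    apply: le_trans h; apply: e'_le; last first.
      apply: F_le => [|z zx]; last exact: f_lip.
      by rewrite mulr_ge0 // addr_ge0 // ltW.
    by rewrite ler_wpM2r // (le_trans s1) // lerDl ltW.
- move=> x y xx yx; apply/eqP; rewrite eq_le; apply/andP; split.
    apply: e'_le; first exact: sD.
    apply: F_le => [|z zx]; first by apply: le_trans (sD _ _ xx yx); rewrite mulr_ge0 // ltW.
    have [_ s1' t1] := Dm _ _ zx xx; have [_ s2' t2] := Dm _ _ zx yx.
    have [_ s3' _] := Dm _ _ xx yx.
    by rewrite !f_D // ler_norml; have := t1 _ yx; have := t2 _ xx; rewrite -s3'; lra.
  (* The term [z = x] of the maximum is already [D x y]. *)
  apply: le_trans (F_e' x y); apply: le_trans (le_F x y x xx).
  rewrite !f_D //; have [[_ ->] // _ _] := Dm _ _ xx xx.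
  by rewrite sub0r normrN ler_norm.
- move=> x y; rewrite ler_norml; apply/andP; split; last first.
    rewrite lerBlDl; apply: e'_le.
      by have := ler_wpM2r (ege0 x y) s1; rewrite mul1r; lra.
    by apply: F_le => [|z zx]; [have := ege0 x y; lra|have := f_near z x y zx; lra].
  (* For [z] near [x], [f z y - f z x] is at least [e x y - 2 * e x z - 2 * eps]; this gives the
     constant 4. *)
  have [z zx xz] := net x.
  have := le_trans (le_F x y z zx) (F_e' x y); rewrite ler_norml /f => /andP[h _].
  have [_ gz _] := gP _ zx; move: (gz x) (gz y); rewrite !ler_norml.
  by have := et x z y; move: h; rewrite (es z x); lra.
Qed.

(* The new distances are moved towards the constant [M]; this makes every
   triangle inequality that involves a new distance strict, so that the
   distances can then be rounded. *)
Lemma rational_metric e xs ys (eta : R) :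
  metric_on e -> (forall x y, x \in xs -> y \in xs -> nnrat (e x y)) -> 0 < eta ->
  exists D, [/\ metric_in (xs ++ ys) D,
    forall x y, x \in xs -> y \in xs -> D x y = e x y,
    forall x y, nnrat (D x y) &
    forall x y, x \in xs ++ ys -> y \in xs ++ ys -> `|D x y - e x y| <= eta].
Proof.
move=> em rat eta0; have [[e0 es et] _] := em.
have ege0 x y := metric_on_ge0 x y em.
set zs := xs ++ ys.
have [|m m0 mP] := @pair_lower_bound R T zs e.
  by move=> x y _ _; exact: metric_on_gt0.
have [M' M'0 M'P] := @pair_upper_bound R T zs e.
pose M := Num.max M' m.
have MP x y : x \in zs -> y \in zs -> e x y <= M.
  by move=> xz yz; rewrite le_max M'P.
have M0 : 0 < M by rewrite lt_max m0 orbT.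
have mM : m <= M by rewrite le_max lexx orbT.
pose t := Num.min 1 (eta / (2 * M)).
have t0 : 0 < t by rewrite lt_min ltr01 divr_gt0 // mulr_gt0.
have t1 : t <= 1 by rewrite ge_min lexx.
have tM : t * M <= eta / 2.
  have : t * M <= eta / (2 * M) * M by rewrite ler_pM2r // ge_min lexx orbT.
  by rewrite invfM mulrA divfK // gt_eqF.
clearbody t M; clear M' M'0 M'P.
have tm0 : 0 < t * m by rewrite mulr_gt0.
have [r rP rrat] : exists2 r : R -> R,
    forall v, 0 <= v -> v - t * m / 4 < r v <= v & forall v, nnrat (r v).
  have [K KP] : exists K : nat, K.+1%:R^-1 < t * m / 4.
    by apply: exists_inv_lt; rewrite divr_gt0.
  have K0 : 0 < K.+1%:R :> R by rewrite ltr0n.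
  exists (fun v => (Num.trunc (v * K.+1%:R))%:R / K.+1%:R); last first.
    by move=> v; exists (Num.trunc (v * K.+1%:R)), K.
  move=> v v0; have /truncn_itv : 0 <= v * K.+1%:R by rewrite mulr_ge0 // ltW.
  set n := Num.trunc _ => /andP[h1 h2] /=; apply/andP; split.
    apply: lt_trans (_ : v - K.+1%:R^-1 < _); first by rewrite ltrD2l ltrN2.
    by rewrite ltrBlDr -[X in _ + X]mul1r -mulrDl ltr_pdivlMr // natr1.
  by rewrite ler_pdivrMr.
pose b x y := (1 - t) * e x y + t * M.
have b0 x y : 0 <= b x y.
  by rewrite addr_ge0 ?mulr_ge0 ?subr_ge0 // ltW.
pose D x y := if ((x \in xs) && (y \in xs)) || (x == y) then e x y else r (b x y).
have round x y := rP _ (b0 x y).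
have tM_tm : t * m <= t * M by rewrite ler_pM2l.
have te_M x y : x \in zs -> y \in zs -> t * e x y <= t * M.
  by move=> xz yz; rewrite ler_pM2l ?MP.
have te_m x y : x \in zs -> y \in zs -> x <> y -> t * m <= t * e x y.
  by move=> xz yz xy; rewrite ler_pM2l ?mP.
have Dxx x : D x x = 0 by rewrite /D eqxx orbT e0.
have Dsym x y : D x y = D y x.
  by rewrite /D /b es eq_sym andbC.
have Dgt0 x y : x <> y -> 0 < D x y.
  move=> xy; rewrite /D; case: ifP => _; first exact: metric_on_gt0.
  have /andP[+ _] := round x y; apply: le_lt_trans; rewrite /b.
  have : 0 <= (1 - t) * e x y by rewrite mulr_ge0 // subr_ge0.
  lra.
have Dge0 x y : 0 <= D x y.
  by have [->|/eqP/Dgt0/ltW//] := eqVneq x y; rewrite Dxx.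
exists D; split.
- move=> x y xz yz; split => //.
    by split=> [Dxy|->//]; apply: contrapT => /Dgt0; rewrite Dxy ltxx.
  move=> z zz.
  have [<-|/eqP xy] := eqVneq x y; first by rewrite Dxx add0r.
  have [<-|/eqP yz'] := eqVneq y z; first by rewrite Dxx addr0.
  have [<-|/eqP xz'] := eqVneq x z; first by rewrite Dxx addr_ge0.
  have trt u v w : (1 - t) * e u w <= (1 - t) * (e u v + e v w).
    by rewrite ler_wpM2l // subr_ge0.
  have := round x y; have := round y z; have := round x z.
  have := te_M _ _ xz yz; have := te_M _ _ yz zz; have := te_M _ _ xz zz.
  have := te_m _ _ xz yz xy; have := te_m _ _ yz zz yz'; have := te_m _ _ xz zz xz'.
  have := trt x y z; have := et x y z.
  move/eqP/negbTE: xy; move/eqP/negbTE: yz'; move/eqP/negbTE: xz'.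
  rewrite /D => -> -> ->; rewrite !orbF /b /=.
  (* A triangle with a vertex outside [xs] has at least two new sides. Before rounding its
     inequality has slack at least [t * m]; rounding lowers each side on the right by less than
     [t * m / 4]. *)
  by case: (x \in xs); case: (y \in xs); case: (z \in xs) => /=; lra.
- by move=> x y xx yx; rewrite /D xx yx.
- move=> x y; rewrite /D; case: ifP => [/orP[/andP[xx yx]|/eqP ->]|_].
  + exact: rat.
  + by exists 0%N, 0%N; rewrite e0 mul0r.
  + exact: rrat.
- move=> x y xz yz; rewrite /D; case: ifP => _; first by rewrite subrr normr0 ltW.
  have := round x y; rewrite /b /= ler_norml.
  have := te_M _ _ xz yz; have : 0 <= t * e x y by rewrite mulr_ge0 // ltW.
  lra.
Qed.

End MetricPerturbation.

(** * Forcing *)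

Section Stage.
Context {R : realType} {T : metricType R}.
Local Open Scope ring_scope.
Local Open Scope classical_set_scope.
Implicit Types (e : T -> T -> R) (xs ys zs ws l : seq T).

Definition accumulation (z : T) : Prop :=
  forall eta : R, 0 < eta -> exists2 y, y <> z & mdist z y < eta.

Lemma accumulation_avoid z l (eta : R) : accumulation z -> 0 < eta ->
  exists2 y, y \notin l & mdist z y < eta.
Proof.
move=> az eta0.
have [|m m0 mP] := seq_lower_bound (l := [seq w <- l | w != z]) (F := mdist z).
  by move=> x; rewrite mem_filter mdist_gt0 eq_sym => /andP[].
have [|y /eqP yz] := az (Num.min eta m); first by rewrite lt_min eta0.
rewrite lt_min => /andP[zy zym]; exists y => //; apply/negP => yl.
by have := mP y; rewrite mem_filter yz yl leNgt zym => /(_ isT).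
Qed.

(** Near an accumulation point that point itself serves; near an isolated point there is no other
    point. Compactness reduces both cases to a finite list. *)
Lemma accumulation_net (delta : R) : compact [set: T] -> 0 < delta ->
  exists l, forall x, x \in l \/
    exists2 z, z \in l & accumulation z /\ mdist x z < delta.
Proof.
move=> /compact_near_coveringP cT delta0.
(* Generated by the sets of lists that contain a given list; the near-covering form of compactness
   then yields one list for all points. *)
pose F := filter_from setT (fun l : seq T => [set l' : seq T | {subset l <= l'}]).
have FF : Filter F.
  apply: filter_from_filter; first by exists [::].
  move=> l1 l2 _ _; exists (l1 ++ l2) => // l' h; split=> x xl; apply: h;
    by rewrite mem_cat xl ?orbT.
have [|l0 _ hl0] := cT _ F (fun l x => x \in l \/
    exists2 z, z \in l & accumulation z /\ mdist x z < delta) FF; last first.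
  by exists l0 => x; exact: (hl0 l0).
move=> x _.
have Fx : F [set l : seq T | x \in l] by exists [:: x] => // l; apply; rewrite mem_head.
have [ax|] := pselect (accumulation x).
  exists (ball x delta, [set l : seq T | x \in l]) => /=.
    by split => //; exact: nbhsx_ballx.
  move=> [y l] /= [+ xl]; rewrite ballEmdist /= => xy.
  by right; exists x => //; split => //; rewrite metric_sym.
move=> /existsNP[eta /not_implyP[eta0 iso]].
exists (ball x eta, [set l : seq T | x \in l]) => /=.
  by split => //; exact: nbhsx_ballx.
move=> [y l] /= [+ xl]; rewrite ballEmdist /= => xy; left.
by have -> : y = x by apply: contrapT => yx; apply: iso; exists y.
Qed.

Lemma choose_near zs (target : nat -> T) (k : nat) (eta : R) x0 :
  uniq zs -> 0 < eta -> (forall i, (i < k)%N -> accumulation (target i)) ->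
  exists ws, [/\ size ws = k, uniq (zs ++ ws) &
    forall i, (i < k)%N -> mdist (target i) (nth x0 ws i) < eta].
Proof.
move=> uz eta0; elim: k => [|k IH] acc; first by exists [::]; rewrite cats0.
have [i ik|ws [sw uw nw]] := IH; first by apply: acc; exact: ltnW.
have [y yl yk] := accumulation_avoid (zs ++ ws) (acc k (ltnSn k)) eta0.
exists (rcons ws y); split; first by rewrite size_rcons sw.
  by rewrite -rcons_cat rcons_uniq yl.
move=> i; rewrite ltnS leq_eqVlt nth_rcons sw => /predU1P[->|ik].
  by rewrite ltnn eqxx.
by rewrite ik; exact: nw.
Qed.

(** The new rows are realized at fresh points close to the accumulation points given by [pi]. There
    the distances of [k] and of [e] differ by a multiple of [tau], and [metric_amalgam] spreads the
    correction. *)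
Lemma realize_code e zs (k : nat) (pi : nat -> nat) (tau : R) x0 :
  bilipschitz_metric e -> uniq zs -> 0 < tau ->
  (forall x, exists2 z, z \in zs & e x z <= tau) ->
  (size zs <= msize k)%N ->
  (forall i j, (i < size zs)%N -> (j < size zs)%N ->
    mval k i j = e (nth x0 zs i) (nth x0 zs j)) ->
  finite_metric (msize k) (mval k : nat -> nat -> R) ->
  (forall i, (size zs <= i < msize k)%N -> [/\ (pi i < size zs)%N,
    accumulation (nth x0 zs (pi i)) & mval k i (pi i) < tau]) ->
  exists ws e', [/\ size (zs ++ ws) = msize k, uniq (zs ++ ws),
    bilipschitz_metric e',
    forall i j, (i < msize k)%N -> (j < msize k)%N ->
      e' (nth x0 (zs ++ ws) i) (nth x0 (zs ++ ws) j) = mval k i j &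
    forall x y, `|e' x y - e x y| <= 16 * tau].
Proof.
move=> eb uz tau0 net szk mold fm piP.
have [em _ [L L0 LP]] := eb; have [[e0 es et] _] := em.
have [||ws [sw uw nw]] := @choose_near zs (fun i => nth x0 zs (pi (size zs + i)))
    (msize k - size zs)%N (tau / L) x0 uz.
- by rewrite divr_gt0.
- by move=> i ik; have [] := piP (size zs + i)%N; first lia.
set xs := zs ++ ws.
have sx : size xs = msize k by rewrite size_cat sw; lia.
pose D x y : R := mval k (index x xs) (index y xs).
have idx x : x \in xs -> (index x xs < msize k)%N by rewrite -sx index_mem.
have Dm : metric_in xs D.
  move=> x y xx yx; have [z s t] := fm _ _ (idx _ xx) (idx _ yx); split => //.
    split=> [/z|->]; last by have [[_ h] _ _] := fm _ _ (idx _ yx) (idx _ yx); exact: h.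
    by move=> E; rewrite -(nth_index x0 xx) E nth_index.
  by move=> w wx; exact: t (idx _ wx).
have Dold x y : x \in zs -> y \in zs -> D x y = e x y.
  move=> xz yz; rewrite /D /xs !index_cat xz yz.
  by rewrite mold ?index_mem // !nth_index.
(* An anchor is an old point close to [x] in both [D] and [e]. As these agree on anchors, they
   differ on [xs] by four detours of length at most [tau]; amalgamation multiplies this by 4. *)
have anchor x : x \in xs -> exists z, [/\ z \in zs, D x z <= tau & e x z <= tau].
  rewrite /xs mem_cat => /orP[xz|xw].
    by exists x; split => //; rewrite ?Dold // e0 ltW.
  have xnz : x \notin zs.
    by apply/negP => xz; move: uw; rewrite cat_uniq => /and3P[_ /hasPn/(_ _ xw)]; rewrite /= xz.
  set i := index x ws; have iw : (i < size ws)%N by rewrite index_mem.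
  have [piz _ hk] : [/\ (pi (size zs + i) < size zs)%N,
      accumulation (nth x0 zs (pi (size zs + i))) &
      mval k (size zs + i) (pi (size zs + i)) < tau] by apply: piP; lia.
  exists (nth x0 zs (pi (size zs + i))); split; first exact: mem_nth.
    rewrite /D /xs !index_cat (negbTE xnz) mem_nth // index_uniq //.
    exact: ltW.
  have := nw i; rewrite -sw nth_index // => /(_ iw) h.
  rewrite es; apply: le_trans (LP _ _) _.
  by rewrite mulrC -ler_pdivlMr // ltW.
have De x y : x \in xs -> y \in xs -> `|D x y - e x y| <= 4 * tau.
  have zx z : z \in zs -> z \in xs by rewrite mem_cat => ->.
  move=> xx yx; have [u [uz' Du eu]] := anchor _ xx; have [v [vz Dv ev]] := anchor _ yx.
  have [_ sxu t1] := Dm _ _ xx (zx _ uz'); have [_ _ t2] := Dm _ _ (zx _ uz') (zx _ vz).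
  have [_ syv t3] := Dm _ _ yx (zx _ vz).
  have [_ _ t4] := Dm _ _ (zx _ uz') xx.
  have [_ _ t5] := Dm _ _ xx yx.
  have := t1 _ yx; have := t2 _ yx; have := t4 _ (zx _ vz); have := t5 _ (zx _ vz).
  have := et x u y; have := et u v y; have := et u x v; have := et x y v.
  by rewrite ler_norml (Dold u v) // (es v y) (es u x) -sxu -syv; lra.
have [e' [eb' e'D e'e]] : exists e', [/\ bilipschitz_metric e',
    forall x y, x \in xs -> y \in xs -> e' x y = D x y &
    forall x y, `|e' x y - e x y| <= 4 * (4 * tau)].
  apply: metric_amalgam => //; first by rewrite mulr_gt0.
  move=> x; have [z zz xz] := net x; exists z; first by rewrite mem_cat zz.
  by apply: (le_trans xz); lra.
exists ws, e'; split => //.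
- move=> i j ik jk; rewrite e'D ?mem_nth ?sx // /D !index_uniq ?sx //.
- by move=> x y; apply: le_trans (e'e x y) _; lra.
Qed.

Definition condition (e : T -> T -> R) xs (eps : R) : Prop :=
  [/\ bilipschitz_metric e, uniq xs,
      forall x y, x \in xs -> y \in xs -> nnrat (e x y) & 0 < eps].

(** What a condition promises about the final metric and sequence. A stage has to defeat its program
    for all such pairs, as the limit is not known yet. *)
Definition models (x : nat -> T) (d e : T -> T -> R) xs (eps : R) : Prop :=
  [/\ metric_on d /\ injective x, forall i j, nnrat (d (x i) (x j)),
      mkseq x (size xs) = xs,
      forall u v, u \in xs -> v \in xs -> d u v = e u v &
      forall u v, `|d u v - e u v| <= eps].

(** A metric within [eps] of [e] keeps points that are [delta] apart at distance at least [eps], so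
    the limit cannot collapse them. *)
Lemma small_tolerance e (delta b : R) : bilipschitz_metric e -> 0 < delta -> 0 < b ->
  exists eps, [/\ 0 < eps, eps <= b &
    forall x y, delta <= mdist x y -> 2 * eps <= e x y].
Proof.
move=> [_ [s s0 sP] _] d0 b0; exists (Num.min b (s * delta / 2)); split.
- by rewrite lt_min b0 divr_gt0 // mulr_gt0.
- by rewrite ge_min lexx.
- move=> x y dxy; apply: le_trans (sP _ _).
  apply: le_trans (_ : s * delta <= _); last by rewrite ler_pM2l.
  have : Num.min b (s * delta / 2) <= s * delta / 2 by rewrite ge_min lexx orbT.
  lra.
Qed.

(** The last clause defeats [c]. The others make the stages converge to a metric uniformly
    equivalent to [mdist], along a dense sequence. *)
Lemma stage (A : set nat) (c : prog) e xs (eps delta : R) :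
  ~ ce A -> compact [set: T] -> infinite_set [set: T] -> 0 < delta ->
  condition e xs eps ->
  exists e' ys eps', [/\ condition e' (xs ++ ys) eps',
    [/\ (0 < size ys)%N, eps' <= eps / 2,
        forall x y, `|e' x y - e x y| <= eps / 2 &
        forall x y, x \in xs -> y \in xs -> e' x y = e x y],
    forall x, exists2 z, z \in xs ++ ys & mdist x z < delta,
    forall x y, delta <= mdist x y -> 2 * eps' <= e' x y &
    forall x d, models x d e' (xs ++ ys) eps' ->
      ~ (forall n, A n <->
        exists r, peval (metric_oracle (fun i j => d (x i) (x j))) c n r)].
Proof.
move=> nA cT iT delta0 [eb ux rat eps0].
have [em _ [L L0 LP]] := eb; have [[e0 es et] _] := em.
(* The metric will change by at most [tau / 2] when made rational on the net and by [16 * tau] when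
   a code is realized, together less than [eps / 2]. *)
have [T0 tauP] : exists T0 : nat, T0.+1%:R^-1 < eps / 40.
  by apply: exists_inv_lt; rewrite divr_gt0.
set tau : R := T0.+1%:R^-1 in tauP.
have tau0 : 0 < tau by rewrite invr_gt0 ltr0n.
have tauE : tau = T0.+1%:R^-1 by [].
clearbody tau.
(* This point makes the sequence grow at every stage; it also serves as the default of [nth]. *)
have [w wx] : exists w, w \notin xs.
  apply: contrapT => /forallNP h; apply: iT; apply/finite_seqP; exists xs.
  by apply/seteqP; split=> // x _ /=; have /negP := h x; rewrite negbK.
pose delta1 := Num.min delta (tau / 8 / L).
have delta10 : 0 < delta1 by rewrite lt_min delta0 !divr_gt0.
have [l lP] := accumulation_net cT delta10.
pose ys := undup [seq z <- w :: l | z \notin xs].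
set zs := xs ++ ys.
have zsP z : z \in w :: l -> z \in zs.
  by rewrite mem_cat mem_undup mem_filter => ->; rewrite andbT; case: (z \in xs).
have uz : uniq zs.
  rewrite cat_uniq ux undup_uniq andbT /=; apply/hasPn => z.
  by rewrite mem_undup mem_filter => /andP[].
have ys0 : (0 < size ys)%N.
  have : w \in ys by rewrite mem_undup mem_filter wx mem_head.
  by case: (ys).
have netz x : x \in zs \/
    exists2 z, z \in zs & [/\ accumulation z, mdist x z < delta & e x z <= tau / 8].
  have [xl|[z zl [az xz]]] := lP x; first by left; apply: zsP; rewrite inE xl orbT.
  right; exists z; first by apply: zsP; rewrite inE zl orbT.
  move: xz; rewrite lt_min => /andP[xz1 xz2]; split => //.
  by apply: le_trans (LP _ _) _; rewrite mulrC -ler_pdivlMr // ltW.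
have [D [Dm Dold Drat De]] := rational_metric ys em rat (divr_gt0 tau0 (ltr0n R 8)).
have [e1 [eb1 e1D e1e]] : exists e', [/\ bilipschitz_metric e',
    forall x y, x \in zs -> y \in zs -> e' x y = D x y &
    forall x y, `|e' x y - e x y| <= 4 * (tau / 8)].
  apply: metric_amalgam => //; first by rewrite divr_gt0.
  move=> x; have [xz|[z zz [_ _ xz]]] := netz x; last by exists z.
  by exists x => //; rewrite e0 divr_ge0 // ltW.
have e1rat x y : x \in zs -> y \in zs -> nnrat (e1 x y).
  by move=> xz yz; rewrite e1D.
have e1old x y : x \in xs -> y \in xs -> e1 x y = e x y.
  by move=> xx yx; rewrite e1D ?Dold // mem_cat ?xx ?yx.
have net1 x : exists2 z, z \in zs & mdist x z < delta.
  have [xz|[z zz [_ xz _]]] := netz x; last by exists z.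
  by exists x => //; rewrite mdistxx.
have [em1 _ _] := eb1; have [[e10 es1 et1] _] := em1.
have nthz i : nth w zs i \in zs.
  have [iz|iz] := ltnP i (size zs); first exact: mem_nth.
  by rewrite nth_default //; apply: zsP; rewrite mem_head.
have [od so oP] : exists2 k, msize k = size zs &
    agrees (fun i j => e1 (nth w zs i) (nth w zs j)) k.
  by apply: code_exists => i j; exact: e1rat.
(* Which points of the net accumulate is finite information, so the search can be given it as the
   number [fl]. *)
have [fl flP] := dec_surj (fun u => `[< accumulation (nth w zs u) >] : nat) (size zs).
have [n [[nAn [k [t [ext evk]]]]|[An none]]] := not_ce_extension c od fl T0 nA.
(* Some extension halts outside [A]. Once it is realized, its matrix is part of the condition, so
   every model repeats the computation. *)
- have [ok kold fm knear] := (extensionP (R := R) od fl T0 k).1 ext.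
  have /choice[pi piP] : forall i, exists u, (size zs <= i < msize k)%N ->
      [/\ (u < size zs)%N, accumulation (nth w zs u) & mval k i u < tau].
    move=> i; have [|_] := boolP (size zs <= i < msize k)%N; last by exists 0%N.
    rewrite -so => /knear[u [uo fu mu]]; exists u; split; rewrite -?so ?tauE //.
    by move: fu; rewrite flP -?so //; case: asboolP.
  have [|||ws [e2 [sx ux2 eb2 e2k e2e]]] :=
      realize_code (pi := pi) (k := k) (x0 := w) eb1 uz tau0 _ _ _ fm piP.
  + move=> x; have [xz|[z zz [_ _ xz]]] := netz x.
      by exists x => //; rewrite e10 ltW.
    by exists z => //; have := e1e x z; rewrite ler_norml; lra.
  + by rewrite -so.
  + by move=> i j iz jz; rewrite kold ?so // -oP ?so.
  have e2old x y : x \in zs -> y \in zs -> e2 x y = e1 x y.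
    move=> xz yz.
    have ix : (index x zs < size zs)%N by rewrite index_mem.
    have iy : (index y zs < size zs)%N by rewrite index_mem.
    have := e2k (index x zs) (index y zs); rewrite !(nth_cat w zs ws) ix iy !nth_index // => ->.
    + by rewrite kold ?so // -oP ?so // !nth_index.
    + by apply: leq_trans ix _; rewrite -so.
    + by apply: leq_trans iy _; rewrite -so.
  have rat2 x y : x \in zs ++ ws -> y \in zs ++ ws -> nnrat (e2 x y).
    move=> xx yx; rewrite -(nth_index w xx) -(nth_index w yx).
    by rewrite e2k -?sx ?index_mem //; exact: mval_nnrat.
  have [eps' [eps'0 eps'e sep]] := small_tolerance eb2 delta0 (divr_gt0 eps0 (ltr0n R 2)).
  exists e2, (ys ++ ws), eps'; rewrite catA -/zs; split => //.
  + split => //; first by rewrite size_cat addn_gt0 ys0.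
      by move=> x y; have := e2e x y; have := e1e x y; rewrite !ler_norml; lra.
    by move=> x y xx yx; rewrite e2old ?e1old // mem_cat ?xx ?yx.
  + by move=> x; have [z zz xz] := net1 x; exists z => //; rewrite mem_cat zz.
  + move=> x d [_ _ xz dE _] /(_ n)[_ h]; apply: nAn; apply: h.
    apply: (@halts_of_code R _ c k t n) evk => i j ik jk.
    have nx a : (a < msize k)%N -> x a = nth w (zs ++ ws) a.
      by move=> ak; rewrite -xz nth_mkseq ?sx.
    by rewrite !nx // dE ?mem_nth ?sx // e2k.
(* No extension halts on [n], which lies in [A]. If a model did, its initial part, long enough for
   the computation and for the old matrix, would be coded by an extension. *)
- have [eps' [eps'0 eps'm sep]] : exists eps', [/\ 0 < eps',
      eps' <= Num.min (eps / 2) (tau / 8) &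
      forall x y, delta <= mdist x y -> 2 * eps' <= e1 x y].
    by apply: small_tolerance => //; rewrite lt_min !divr_gt0.
  move: eps'm; rewrite le_min => /andP[eps'e eps't].
  exists e1, ys, eps'; split => //.
    split => //.
    by move=> x y; have := e1e x y; rewrite !ler_norml; lra.
  rewrite -/zs => x d [[dm xinj] drat xz dE de] /(_ n)[/(_ An)[r /code_of_halts[m mP]] _].
  have [k sk kP] : exists2 k, msize k = maxn m (size zs) &
      agrees (fun i j => d (x i) (x j)) k by exact: code_exists.
  have [[d0 ds dt] dsep] := dm.
  have nx a : (a < size zs)%N -> x a = nth w zs a.
    by move=> ak; rewrite -[in RHS]xz nth_mkseq.
  have [|t] := mP k _ kP; first by rewrite sk leq_maxl.
  rewrite (none k t) //; apply/(extensionP (R := R)); rewrite so sk; split.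
  + exact: leq_maxr.
  + move=> i j; rewrite so => iz jz.
    by rewrite -oP ?so // -kP ?sk ?leq_max ?iz ?jz ?orbT // !nx // dE.
  + move=> i j ik jk; rewrite -!kP ?sk //; split => //.
      by split=> [/dsep/xinj//|->]; rewrite d0.
    by move=> a ak; rewrite -!kP ?sk.
  + move=> i /andP[zi im].
    (* By injectivity a point listed after the net is not in it, hence is near an accumulation point
       of it. *)
    have [xiz|[z zz [az _ xz']]] := netz (x i).
      have := nth_index w xiz; rewrite -nx ?index_mem // => /xinj E.
      by move: xiz; rewrite -index_mem E ltnNge zi.
    have iz : (index z zs < size zs)%N by rewrite index_mem.
    exists (index z zs); split => //.
      by rewrite flP // nth_index //; case: asboolP.
    rewrite -kP ?sk ?leq_max ?iz ?orbT // -?tauE; last by rewrite -leq_max.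
    rewrite (nx _ iz) nth_index //.
    (* [tau / 8] from the net, [tau / 2] from passing to [e1] and [tau / 8] from the tolerance stay
       below [tau]. *)
    by have := de (x i) z; have := e1e (x i) z; rewrite !ler_norml; lra.
Qed.

End Stage.

(** * Enumeration of programs *)

Fixpoint prog_tree (c : prog) : GenTree.tree nat :=
  match c with
  | PZero => GenTree.Leaf 0
  | PSucc => GenTree.Leaf 1
  | PFst => GenTree.Leaf 2
  | PSnd => GenTree.Leaf 3
  | POracle => GenTree.Leaf 4
  | PPair f g => GenTree.Node 0 [:: prog_tree f; prog_tree g]
  | PComp f g => GenTree.Node 1 [:: prog_tree f; prog_tree g]
  | PPrec f g => GenTree.Node 2 [:: prog_tree f; prog_tree g]
  | PMu f => GenTree.Node 3 [:: prog_tree f]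
  end.

Fixpoint tree_prog (t : GenTree.tree nat) : prog :=
  match t with
  | GenTree.Leaf 0 => PZero
  | GenTree.Leaf 1 => PSucc
  | GenTree.Leaf 2 => PFst
  | GenTree.Leaf 3 => PSnd
  | GenTree.Leaf 4 => POracle
  | GenTree.Node 0 [:: f; g] => PPair (tree_prog f) (tree_prog g)
  | GenTree.Node 1 [:: f; g] => PComp (tree_prog f) (tree_prog g)
  | GenTree.Node 2 [:: f; g] => PPrec (tree_prog f) (tree_prog g)
  | GenTree.Node 3 [:: f] => PMu (tree_prog f)
  | _ => PZero
  end.

Lemma prog_treeK : cancel prog_tree tree_prog.
Proof. by elim=> //= [f -> g ->|f -> g ->|f -> g ->|f ->]. Qed.

Lemma prog_enumeration : exists f : nat -> prog, forall c, exists n, f n = c.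
Proof.
exists (fun n => if unpickle n is Some t then tree_prog t else PZero) => c.
by exists (pickle (prog_tree c)); rewrite pickleK prog_treeK.
Qed.

(** * Construction of the limit metric *)

Section NestedIntervals.
Context {R : realType}.
Local Open Scope ring_scope.
Local Open Scope classical_set_scope.

(** The intervals of radius [p n] around [u n] are nested, and the supremum of their left ends lies
    in all of them. *)
Lemma nested_limit (u p : nat -> R) :
  (forall n, 0 <= p n) -> (forall n, p n.+1 <= p n / 2) ->
  (forall n, `|u n.+1 - u n| <= p n / 2) ->
  exists v, forall n, `|v - u n| <= p n.
Proof.
move=> p0 ph uh.
have mono n k : u n - p n <= u (n + k)%N - p (n + k)%N /\
    u (n + k)%N + p (n + k)%N <= u n + p n.
  elim: k => [|k IH]; first by rewrite addn0.
  rewrite addnS; have := uh (n + k)%N; have := ph (n + k)%N.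
  by rewrite ler_norml; lra.
have lu n m : u n - p n <= u m + p m.
  have [nm|/ltnW mn] := leqP n m.
    have [] := mono n (m - n)%N; rewrite subnKC // => h _.
    by have := p0 m; lra.
  have [] := mono m (n - m)%N; rewrite subnKC // => _ h.
  by have := p0 n; lra.
pose S : set R := range (fun n => u n - p n).
have ubS m : ubound S (u m + p m) by move=> _ [n _ <-].
exists (sup S) => n; rewrite ler_norml.
have : sup S <= u n + p n by apply: ge_sup => //; exists (u 0%N - p 0%N), 0%N.
have : u n - p n <= sup S.
  by apply: ub_le_sup; [exists (u 0%N + p 0%N); exact: ubS|exists n].
lra.
Qed.

End NestedIntervals.

Section Generic.
Context {R : realType} {T : metricType R}.
Local Open Scope ring_scope.
Local Open Scope classical_set_scope.

(** Uniformity makes the Cauchy filters of both metrics the same, so that completeness carries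
    over. *)
Definition uniformly_equivalent (d : T -> T -> R) : Prop :=
  forall eta, 0 < eta -> exists2 delta, 0 < delta &
    forall x y, (mdist x y < delta -> d x y < eta) /\
                (d x y < delta -> mdist x y < eta).

Definition dense_sequence (x : nat -> T) : Prop :=
  forall y (eta : R), 0 < eta -> exists i, mdist y (x i) < eta.

Lemma condition_mdist : condition (@mdist R T) [::] 1.
Proof.
split => //; split.
- split; last exact: mdist_positivity.
  by split; [exact: mdistxx|exact: metric_sym|move=> x y z; exact: metric_triangle].
- by exists 1 => // x y; rewrite mul1r.
- by exists 1 => // x y; rewrite mul1r.
Qed.

(** Stage [n] is run against the [n]-th program with [delta] equal to 1 / (n + 1); the limit is a
    model of every condition in the sequence. *)
Lemma generic_metric (A : set nat) (x0 : T) :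
  ~ ce A -> compact [set: T] -> infinite_set [set: T] ->
  exists (d : T -> T -> R) (x : nat -> T),
    [/\ metric_on d, uniformly_equivalent d, dense_sequence x, injective x &
        ~ ce_rel_metric (fun i j => d (x i) (x j)) A].
Proof.
move=> nA cT iT; have [cs csP] := prog_enumeration.
pose ok (p : (T -> T -> R) * seq T * R) := condition p.1.1 p.1.2 p.2.
pose step n (p q : (T -> T -> R) * seq T * R) := exists ys,
  [/\ q.1.2 = p.1.2 ++ ys,
    [/\ (0 < size ys)%N, q.2 <= p.2 / 2,
        forall x y, `|q.1.1 x y - p.1.1 x y| <= p.2 / 2 &
        forall x y, x \in p.1.2 -> y \in p.1.2 -> q.1.1 x y = p.1.1 x y],
    forall x, exists2 z, z \in q.1.2 & mdist x z < n.+1%:R^-1,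
    forall x y, n.+1%:R^-1 <= mdist x y -> 2 * q.2 <= q.1.1 x y &
    forall x d, models x d q.1.1 q.1.2 q.2 ->
      ~ (forall m, A m <->
        exists r, peval (metric_oracle (fun i j => d (x i) (x j))) (cs n) m r)].
have /choice[next nextP] : forall np : nat * ((T -> T -> R) * seq T * R),
    exists q, ok np.2 -> ok q /\ step np.1 np.2 q.
  move=> [n p]; have [okp|] := pselect (ok p); last by exists p.
  have n0 : 0 < n.+1%:R^-1 :> R by rewrite invr_gt0 ltr0n.
  have [e' [ys [eps' [c' h1 h2 h3 h4]]]] := stage (cs n) nA cT iT n0 okp.
  by exists (e', p.1.2 ++ ys, eps') => _; split => //; exists ys.
pose s := fix s n := if n is m.+1 then next (m, s m) else ((@mdist R T), [::], 1).
have sok n : ok (s n).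
  by elim: n => [|n IH]; [exact: condition_mdist|have [] := nextP (n, s n) IH].
have sstep n : step n (s n) (s n.+1) by have [] := nextP (n, s n) (sok n).
pose E n := (s n).1.1; pose X n := (s n).1.2; pose P n := (s n).2.
have P0 n : 0 < P n by have [] := sok n.
have Ph n : P n.+1 <= P n / 2 by have [ys [_ [_ h _ _] _ _ _]] := sstep n.
have Pn n : P n <= n.+1%:R^-1.
  elim: n => [|n IH]; first by rewrite invr1.
  apply: le_trans (Ph n) _; apply: le_trans (_ : n.+1%:R^-1 / 2 <= _).
    by rewrite ler_pM2r.
  by rewrite -invfM lef_pV2 ?posrE ?mulr_gt0 ?ltr0n // -natrM ler_nat; lia.
have Psmall eta : 0 < eta -> exists n, P n < eta.
  by move=> /exists_inv_lt[n nP]; exists n; exact: le_lt_trans (Pn n) nP.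
have /choice[d0 d0P] : forall xy : T * T, exists v, forall n,
    `|v - E n xy.1 xy.2| <= P n.
  move=> [x y]; apply: nested_limit => n; first exact: ltW.
    exact: Ph.
  by have [ys [_ [_ _ h _] _ _ _]] := sstep n; exact: h.
pose d x y := d0 (x, y).
have dE n x y : `|d x y - E n x y| <= P n := d0P (x, y) n.
clearbody d.
have Em n : metric_on (E n) by have [[]] := sok n.
(* At most three approximations enter an inequality, as in the triangle inequality, and their errors
   tend to 0. *)
have le_approx a b : (forall n, a <= b + 3 * P n) -> a <= b.
  move=> h; rewrite leNgt; apply/negP => ba.
  have [|n nP] := Psmall ((a - b) / 3); first by rewrite divr_gt0 // subr_gt0.
  by have := h n; move: nP; rewrite ltr_pdivlMr //; lra.
have dm : metric_on d.
  split; first split.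
  - move=> x; apply/eqP; rewrite eq_le; apply/andP; split; apply: le_approx => n;
      have := dE n x x; have [[-> _ _] _] := Em n; rewrite subr0 ler_norml;
      by have := P0 n; lra.
  - suff dle x y : d x y <= d y x by move=> x y; apply/eqP; rewrite eq_le !dle.
    apply: le_approx => n; have := dE n x y; have := dE n y x.
    by have [[_ -> _] _] := Em n; rewrite !ler_norml; have := P0 n; lra.
  - move=> x y z; apply: le_approx => n.
    have := dE n x y; have := dE n y z; have := dE n x z.
    by have [[_ _ tri] _] := Em n; have := tri x y z; rewrite !ler_norml; lra.
  (* Distinct points are at least 1 / (n + 1) apart for some [n]; then [E n.+1] is at least
     [2 * P n.+1] on them, and [d] is positive. *)
  - move=> x y dxy; apply: contrapT => /eqP; rewrite -(mdist_gt0 x y).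
    move=> /exists_inv_lt[n /ltW nP].
    have [ys [_ _ _ /(_ _ _ nP) h _]] := sstep n.
    have := dE n.+1 x y; rewrite dxy ler_norml; have := P0 n.+1; move: h.
    by rewrite -/(E n.+1) -/(P n.+1); lra.
have Xsub n k : exists ys, X (n + k)%N = X n ++ ys.
  elim: k => [|k [ys IH]]; first by exists [::]; rewrite addn0 cats0.
  rewrite addnS; have [zs [h _ _ _ _]] := sstep (n + k)%N.
  by exists (ys ++ zs); rewrite catA -IH.
have Xle n m : (n <= m)%N -> exists ys, X m = X n ++ ys.
  by move=> nm; have := Xsub n (m - n)%N; rewrite subnKC.
have Xsize n : (n <= size (X n))%N.
  elim: n => // n IH; have [ys [h [ys0 _ _ _] _ _ _]] := sstep n.
  by rewrite /X h size_cat -/(X n); lia.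
have Eold n m u v : (n <= m)%N -> u \in X n -> v \in X n -> E m u v = E n u v.
  elim: m => [|m IH]; first by rewrite leqn0 => /eqP ->.
  rewrite leq_eqVlt => /predU1P[<-//|nm] un vn.
  have [ys [_ [_ _ _ h] _ _ _]] := sstep m.
  have [zs Xm] := Xle _ _ (nm : (n <= m)%N).
  by rewrite -IH // /E h // -/(X m) Xm mem_cat ?un ?vn.
have dX n u v : u \in X n -> v \in X n -> d u v = E n u v.
  move=> un vn.
  (* From stage [n] on the distances on [X n] are frozen, so the error bounds of later stages apply
     to [E n]; those of earlier stages are weaker anyway. *)
  have close k : `|d u v - E n u v| <= P k.
    have [nk|/ltnW kn] := leqP n k; first by rewrite -(Eold n k).
    apply: le_trans (dE n u v) _; elim: n kn {un vn} => [|n IH].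
      by rewrite leqn0 => /eqP ->.
    rewrite leq_eqVlt => /predU1P[->//|/IH]; apply: le_trans.
    by have := Ph n; have := P0 n; lra.
  apply/eqP; rewrite eq_le; apply/andP; split; apply: le_approx => k;
    by have := close k; rewrite ler_norml; have := P0 k; lra.
(* Every stage adds a point, so [X i.+1] has an entry at [i] and the default is not reached. *)
pose x i := nth x0 (X i.+1) i.
have xE n i : (i < size (X n))%N -> x i = nth x0 (X n) i.
  move=> iX; rewrite /x; have si : (i < size (X i.+1))%N := Xsize i.+1.
  have [/Xle[ys E1]|/ltnW/Xle[ys E1]] := leqP n i.+1.
    by rewrite E1 nth_cat iX.
  by rewrite E1 nth_cat si.
have xX n i : (i < size (X n))%N -> x i \in X n.
  by move=> iX; rewrite (xE n) // mem_nth.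
have big i j : exists n, (i < size (X n))%N /\ (j < size (X n))%N.
  by exists (i + j).+1; have := Xsize (i + j).+1; split; lia.
have xinj : injective x.
  move=> i j; have [n [iX jX]] := big i j; rewrite !(xE n) // => /eqP.
  have [_ un _ _] := sok n.
  by rewrite nth_uniq // => /eqP.
have mod n : models x d (E n) (X n) (P n).
  split => //.
  - move=> i j; have [m [im jm]] := big i j.
    by rewrite (dX m) ?xX //; have [_ _ h _] := sok m; apply: h; exact: xX.
  - apply: (@eq_from_nth _ x0); rewrite size_mkseq // => i iX.
    by rewrite nth_mkseq // (xE n).
  - exact: dX.
exists d, x; split => //.
- move=> eta eta0.
  have [n nP] := Psmall (eta / 2) (divr_gt0 eta0 (ltr0n R 2)).
  have [[_ _ [L L0 LP]] _ _ _] := sok n.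
  have [m mP] := exists_inv_lt eta0.
  (* The first bound makes [E n] less than [eta / 2], hence [d] less than [eta]. For points at
     [mdist] at least [eta], [d] is at least [P m.+1], which the second bound excludes. *)
  exists (Num.min (eta / 2 / L) (P m.+1)).
    by rewrite lt_min !divr_gt0 //=.
  move=> u v; split; rewrite lt_min => /andP[h1 h2].
    have : L * mdist u v < eta / 2 by rewrite mulrC -ltr_pdivlMr.
    by have := LP u v; have := dE n u v; rewrite ler_norml -/(E n); lra.
  rewrite ltNge; apply/negP => eta_uv.
  have [ys [_ _ _ h _]] := sstep m.
  have := h u v (le_trans (ltW mP) eta_uv); have := dE m.+1 u v.
  by rewrite ler_norml -/(E m.+1) -/(P m.+1); lra.
- move=> y eta /exists_inv_lt[n nP]; have [ys [_ _ h _ _]] := sstep n.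
  have [z zX yz] := h y; exists (index z (X n.+1)).
  rewrite (xE n.+1) ?index_mem // nth_index //.
  exact: lt_trans nP.
- move=> [c cP]; have [n cn] := csP c; have [ys [_ _ _ _ h]] := sstep n.
  by apply: (h x d (mod n.+1)) => m; rewrite cn.
Qed.

(** On finitely many points the discrete metric is uniformly equivalent to any other, and by
    [ce_discrete] its oracle does not help to enumerate [A]. *)
Lemma finite_metric_presentation (A : set nat) (x0 : T) :
  ~ ce A -> finite_set [set: T] ->
  exists (d : T -> T -> R) (x : nat -> T),
    [/\ metric_on d, uniformly_equivalent d, dense_sequence x &
        ~ ce_rel_metric (fun i j => d (x i) (x j)) A].
Proof.
move=> nA /finite_seqP[s sT]; pose l := undup s.
have inl z : z \in l by rewrite mem_undup; have : [set: T] z by []; rewrite sT.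
pose K := (size l).-1.
have sl : size l = K.+1 by rewrite /K; have := inl x0; case: (l).
pose d (u v : T) : R := (u != v)%:R.
exists d, (fun i => nth x0 l (minn i K)); split.
- split; first split.
  + by move=> i; rewrite /d eqxx.
  + by move=> i j; rewrite /d eq_sym.
  + move=> i j k; rewrite /d; have [<-|] := eqVneq i j; first by rewrite /= add0r.
    by move=> _; case: (i == k); case: (j == k) => /=; lra.
  + by move=> i j; rewrite /d; have [//|_ /eqP] := eqVneq i j; rewrite oner_eq0.
- move=> eta eta0; have [|m m0 mP] := @pair_lower_bound R T l (@mdist R T).
    by move=> u v _ _ /eqP; rewrite -(mdist_gt0 u v).
  exists (Num.min m 1); first by rewrite lt_min m0 ltr01.
  move=> u v; rewrite /d !lt_min.
  have [->|/eqP uv] := eqVneq u v; first by rewrite mdistxx.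
  split; first by have := mP u v (inl u) (inl v) uv; rewrite ltNge => ->.
  by rewrite ltxx andbF.
- move=> y eta eta0; exists (index y l).
  have iy : (index y l < size l)%N by rewrite index_mem.
  by rewrite (minn_idPl _) ?nth_index ?mdistxx //; move: iy; rewrite sl ltnS.
- apply: contra_not nA => h; apply: (@ce_discrete R K).
  move: h; congr ce_rel_metric; apply/funext => i; apply/funext => j.
  by rewrite /d nth_uniq ?undup_uniq // sl ltnS geq_minr.
Qed.

End Generic.

(** * Presentations from uniformly equivalent metrics *)

(** A copy of [T] indexed by the proof [dm], so that the new metric structure does not clash with
    that of [T]. *)
Definition remetric (R : realType) (T : choiceType) (d : T -> T -> R)
  (dm : metric_on d) : Type := T.

Section Remetric.
Context (R : realType) (T : choiceType) (d : T -> T -> R) (dm : metric_on d).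
Local Open Scope ring_scope.

Let dxx (x : T) : d x x = 0. Proof. by case: dm => -[]. Qed.
Let dsep (x y : T) : d x y = 0 -> x = y. Proof. by case: dm => _; apply. Qed.
Let dsym (x y : T) : d x y = d y x. Proof. by case: dm => -[]. Qed.
Let dtri (y x z : T) : d x z <= d x y + d y z. Proof. by case: dm => -[]. Qed.

HB.instance Definition _ := Choice.on (remetric dm).
HB.instance Definition _ := @isMetric.Build R (remetric dm) d dxx dsep dsym dtri.

End Remetric.

Section Presentation.
Context {R : realType} {T : metricType R} (X : topologicalType).
Local Open Scope ring_scope.
Local Open Scope classical_set_scope.

Lemma presentation_of_metric (d : T -> T -> R) (x : nat -> T) :
  complete_metric_space T -> homeomorphic T X ->
  metric_on d -> uniformly_equivalent d -> dense_sequence x ->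
  (infinite_set [set: X] -> injective x) ->
  polish_presentation X (fun i j => d (x i) (x j)).
Proof.
move=> cT [f [g [fg gf fc gc]]] dm ue dx xinj.
pose Y : metricType R := remetric dm.
have [[d0 ds dt] dsep] := dm.
(* The identity between [T] and [Y] is continuous in both directions; [toY] and [toT] express this
   for filters. *)
have toY (F : set_system T) : Filter F -> forall y : T, F --> y ->
    (F : set_system Y) --> (y : Y).
  move=> FF y /metricType_numDomainType.fcvgrPdist_lt Fy.
  apply/(@metricType_numDomainType.fcvgrPdist_lt R Y F FF) => eps eps0.
  have [delta delta0 h] := ue _ eps0.
  by apply: filterS (Fy _ delta0) => z; have [h1 _] := h y z.
have toT (F : set_system Y) : Filter F -> forall y : Y, F --> y ->
    (F : set_system T) --> (y : T).
  move=> FF y /metricType_numDomainType.fcvgrPdist_lt Fy.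
  apply/(@metricType_numDomainType.fcvgrPdist_lt R T F FF) => eps eps0.
  have [delta delta0 h] := ue _ eps0.
  by apply: filterS (Fy _ delta0) => z; have [_ h2] := h y z.
split.
- by split=> [i|i j|i j k]; [exact: d0|exact: ds|exact: dt].
- move=> /xinj xi; split; last by move=> i j /dsep/xi.
  by split=> [i|i j|i j k]; [exact: d0|exact: ds|exact: dt].
exists Y, x; split; first split.
- move=> F PF /cauchy_ballP cF.
  have [|y Fy] := cT (F : set_system T) PF; last by exists y; exact: toY.
  apply/cauchy_ballP => eps eps0; have [delta delta0 h] := ue _ eps0.
  apply: filterS (cF _ delta0) => -[u v] /=.
  by rewrite !ballEmdist /=; have [_ h2] := h u v.
- by [].
- move=> U [y Uy] oU.
  have /nbhs_ballP[eps /= eps0 hU] : nbhs (y : Y) U by exact: open_nbhs_nbhs.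
  have [delta delta0 h] := ue _ eps0; have [i xi] := dx y _ delta0.
  exists (x i); split; last by exists i.
  by apply: hU; rewrite ballEmdist /=; have [h1 _] := h y (x i); exact: h1.
- exists (f : Y -> X), (g : X -> Y); split => //.
  + move=> y; apply: cvg_trans (fc y); apply: cvg_app.
    exact: (toT (nbhs (y : Y)) _ y cvg_id).
  + by move=> y; apply: toY; exact: gc.
Qed.

End Presentation.

Local Open Scope classical_set_scope.

Lemma homeomorphic_compact (X Y : topologicalType) :
  homeomorphic X Y -> compact [set: Y] -> compact [set: X].
Proof.
move=> [f [g [fg _ _ gc]]] cY.
have -> : [set: X] = (g @` [set: Y]).
  by apply/seteqP; split=> // x _; exists (f x).
by apply: continuous_compact => //; exact: continuous_subspaceT.
Qed.

Theorem theorem4p1 (R : realType) (A : set nat) (A_not_ce : ~ ce A)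
    (X : topologicalType) (X_nonempty : [set: X] !=set0)
    (X_polish : polish_space R X) (X_compact : compact [set: X]) :
  exists d : nat -> nat -> R,
    polish_presentation X d /\ ~ ce_rel_metric d A.
Proof.
have [_ [T cT hT]] := X_polish.
have kT := homeomorphic_compact hT X_compact.
have [f [g [fg gf _ _]]] := hT; have [p _] := X_nonempty.
have [fT|iT] := pselect (finite_set [set: T]).
  have [d [x [dm ue dx nc]]] := finite_metric_presentation (g p) A_not_ce fT.
  exists (fun i j => d (x i) (x j)); split => //.
  (* The sequence repeats a point; injectivity is demanded only of an infinite [X]. *)
  apply: presentation_of_metric => // iX; exfalso; apply: iX.
  have -> : [set: X] = (f @` [set: T]).
    by apply/seteqP; split=> // y _; exists (g y).
  exact: finite_image.
have [d [x [dm ue dx xi nc]]] := generic_metric (g p) A_not_ce kT iT.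
exists (fun i j => d (x i) (x j)); split => //.
exact: presentation_of_metric.
Qed.
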